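(* Let $\Phi=(\Phi^{(j)})_{j\in\mathbb{N}}$ be an analytic NIFS on $(U,X)$ and suppose that for some integer $n>1$, writing $\widetilde{\Phi}^{(1)}=\Phi^{(1)}\circ\cdots\circ\Phi^{(n-1)}=\{f_1\circ\cdots\circ f_{n-1}: f_i\in\Phi^{(i)}\}$, the following hold: (i) $\overline{J^{(n)}}$ is pointwise thin; (ii) $\widetilde{\Phi}^{(1)}$ is finite, and $\varphi_a(\overline{J^{(n)}})\cap\varphi_b(\overline{J^{(n)}})=\emptyset$ for all distinct $\varphi_a,\varphi_b\in\widetilde{\Phi}^{(1)}$; (iii) for every $\varphi_a\in\widetilde{\Phi}^{(1)}$ and every $z\in\overline{J^{(n)}}$, the point $z$ is the only point of $\overline{J^{(n)}}$ which $\varphi_a$ maps to $\varphi_a(z)$. Then $\overline{J(\Phi)}$ is pointwise thin.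
   Context: NIFS. Let $U\subseteq\mathbb{C}$ be non-empty, open and connected and let $X\subset U$ be compact. A non-autonomous iterated function system (NIFS) $\Phi$ on $(U,X)$ is a sequence $\Phi^{(1)},\Phi^{(2)},\dots$, where each $\Phi^{(j)}=(\varphi^{(j)}_i:U\to X)_{i\in I^{(j)}}$ is a collection of non-constant functions indexed by a non-empty set $I^{(j)}$ (of arbitrary cardinality), such that there exist $0<s<1$ and a metric $d$ on $U$, inducing the Euclidean topology on $X$, with $d(\varphi(z),\varphi(w))\le s\,d(z,w)$ for all $z,w\in X$ and all $\varphi\in\bigcup_j\Phi^{(j)}$. The NIFS is analytic if all its maps are complex analytic on $U$. Limit sets. For $j,k\in\mathbb{N}$ let $X^{(j)}_k$ be the union of the sets $\varphi^{(j)}_{\omega_1}\circ\varphi^{(j+1)}_{\omega_2}\circ\cdots\circ\varphi^{(j+k-1)}_{\omega_k}(X)$ over all $(\omega_1,\dots,\omega_k)\in I^{(j)}\times\cdots\times I^{(j+k-1)}$, and let $J^{(j)}=\bigcap_{k=1}^\infty X^{(j)}_k$. The limit set of $\Phi$ is $J(\Phi)=J^{(1)}$. Closures are Euclidean. Annuli and thinness. A conformal annulus is a doubly connected domain $A\subset\mathbb{C}$ that can be mapped conformally onto a round annulus $\{z:r<|z-w|<R\}$ with $0<r<R<\infty$; its modulus is $\mathrm{mod}\,A=\log(R/r)$. It separates a set $F\subset\mathbb{C}$ if $F\cap A=\emptyset$ and $F$ meets both components of $\mathbb{C}\setminus A$. A set $E\subset\mathbb{C}$ is pointwise thin at $z\in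 E$ if there is a sequence of conformal annuli $A_n$, each of which separates $E$ and has $z$ in the bounded component of its complement, such that $\mathrm{mod}\,A_n\to+\infty$ while the Euclidean diameter of $A_n$ tends to $0$; $E$ is pointwise thin if it is pointwise thin at each of its points. *)

(* Defs.v *)
From HB Require Import structures.
From mathcomp Require Import all_boot all_order all_algebra.
From mathcomp Require Import all_classical all_reals all_analysis.
From mathcomp Require Import complex.

Set Implicit Arguments.
Unset Strict Implicit.
Unset Printing Implicit Defensive.

Import Order.TTheory GRing.Theory Num.Theory.
Import numFieldNormedType.Exports.

Local Open Scope classical_set_scope.
Local Open Scope ring_scope.

(* Going through [numClosedFieldType] gives [R[i]] its Euclidean topology; the
   norm [`|z|] takes its (real) values in [Cplx R], and [complex.Re `|z| : R]. *)
Definition Cplx (R : realType) : numClosedFieldType := R[i].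

(* Local expansion in convergent power series; only used for [U] open. *)
Definition analytic_on (R : realType) (U : set (Cplx R))
    (f : Cplx R -> Cplx R) : Prop :=
  forall z, U z -> exists a : nat -> Cplx R,
    \forall w \near z,
      series (fun k => a k * (w - z) ^+ k) x @[x --> \oo] --> f w.

Section Annuli.
Variable R : realType.
Local Notation C := (Cplx R).

Definition components (S : set C) : set (set C) := connected_component S @` S.

(* The complement is taken in the plane, not in the Riemann sphere. The two
   readings differ only for unbounded domains. *)
Definition doubly_connected (A : set C) : Prop :=
  [/\ open A, connected A, A !=set0 &
      exists K L, K <> L /\ components (~` A) = [set K; L]].

Definition round_annulus (w : C) (r1 r2 : R) : set C :=
  [set z | r1 < complex.Re `|z - w| < r2].

Definition conformal_onto (A B : set C) (f : C -> C) : Prop :=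
  analytic_on A f /\ set_bij A B f.

Definition has_modulus (A : set C) (m : R) : Prop :=
  exists (f : C -> C) (w : C) (r1 r2 : R),
    [/\ 0 < r1, r1 < r2, conformal_onto A (round_annulus w r1 r2) f &
        m = ln (r2 / r1)].

Definition conformal_annulus (A : set C) : Prop :=
  doubly_connected A /\ exists m, has_modulus A m.

Definition separates (A F : set C) : Prop :=
  F `&` A = set0 /\ forall K, components (~` A) K -> F `&` K !=set0.

Definition diameter (A : set C) : \bar R :=
  ereal_sup [set (complex.Re `|x - y|)%:E | x in A & y in A].

Definition pointwise_thin_at (E : set C) (z : C) : Prop :=
  exists (A : nat -> set C) (m : nat -> R),
    [/\ forall n, conformal_annulus (A n) /\ has_modulus (A n) (m n),
        forall n, separates (A n) E,
        forall n, exists K, [/\ components (~` A n) K, bounded_set K & K z],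
        m n @[n --> \oo] --> +oo &
        diameter (A n) @[n --> \oo] --> 0%E].

Definition pointwise_thin (E : set C) : Prop :=
  forall z, E z -> pointwise_thin_at E z.

End Annuli.

Section NonAutonomousIFS.
Variable R : realType.
Local Notation C := (Cplx R).

Record metric_on (U : set C) (d : C -> C -> R) : Prop := {
  metric_ge0 : forall x y, U x -> U y -> 0 <= d x y;
  metric_eq0 : forall x y, U x -> U y -> d x y = 0 <-> x = y;
  metric_sym : forall x y, U x -> U y -> d x y = d y x;
  metric_triangle : forall x y z, U x -> U y -> U z ->
    d x z <= d x y + d y z }.

(* The subsets of [X] that are open for [d] restricted to [X] are exactly the
   relatively open ones. *)
Definition induces_euclidean_topology_on (X : set C) (d : C -> C -> R) : Prop :=
  forall A : set C, A `<=` X ->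
    (exists2 O, open O & A = X `&` O) <->
    (forall x, A x -> exists2 e : R, 0 < e &
       forall y, X y -> d x y < e -> A y).

(* Families are numbered from 1 as in [Phi^(1), Phi^(2), ...]: [phi 0] is
   unconstrained and never used. Maps [U -> X] are represented by total
   functions, whose values outside [U] are irrelevant. *)
Record is_NIFS (U X : set C) (I : nat -> Type)
    (phi : forall j, I j -> C -> C) : Prop := {
  nifs_domain_nonempty : U !=set0;
  nifs_domain_open : open U;
  nifs_domain_connected : connected U;
  nifs_compact : compact X;
  nifs_sub : X `<=` U;
  nifs_index : forall j, (0 < j)%N -> inhabited (I j);
  nifs_map : forall j (i : I j), (0 < j)%N -> set_fun U X (phi j i);
  nifs_nonconstant : forall j (i : I j), (0 < j)%N ->
    exists z w, [/\ U z, U w & phi j i z <> phi j i w];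
  nifs_contraction : exists (s : R) (d : C -> C -> R),
    [/\ 0 < s < 1, metric_on U d, induces_euclidean_topology_on X d &
        forall j (i : I j) z w, (0 < j)%N -> X z -> X w ->
          d (phi j i z) (phi j i w) <= s * d z w] }.

Definition is_analytic_NIFS (U X : set C) (I : nat -> Type)
    (phi : forall j, I j -> C -> C) : Prop :=
  is_NIFS U X phi /\
  forall j (i : I j), (0 < j)%N -> analytic_on U (phi j i).

Variables (I : nat -> Type) (phi : forall j, I j -> C -> C).

(* All [phi j w_1 \o phi j.+1 w_2 \o ... \o phi (j + k - 1) w_k]. *)
Fixpoint compositions (j k : nat) : set (C -> C) :=
  match k with
  | 0 => [set id]
  | k'.+1 => [set f \o g | f in range (@phi j) & g in compositions j.+1 k']
  end.

(* The same compositions as maps on [U]: restricting makes equality in this set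
   mean equality on [U]. *)
Definition compositions_on (U : set C) (j k : nat) : set (C -> C) :=
  [set f \_ U | f in compositions j k].

Definition level_set (X : set C) (j k : nat) : set C :=
  \bigcup_(f in compositions j k) (f @` X).

Definition limit_set_from (X : set C) (j : nat) : set C :=
  \bigcap_(k in [set k | (0 < k)%N]) level_set X j k.

Definition limit_set (X : set C) : set C := limit_set_from X 1.

End NonAutonomousIFS.

(* Main.v *)
Require Import Defs.
From mathcomp Require Import all_boot all_order all_algebra.
From mathcomp Require Import all_classical all_reals all_analysis.
From mathcomp Require Import complex.
From mathcomp Require Import ring lra.
Import Order.TTheory GRing.Theory Num.Theory.
Import numFieldNormedType.Exports.
Local Open Scope classical_set_scope.
Local Open Scope ring_scope.

(** Thinness at a point can be tested with round annuli only: a set [E] is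
    pointwise thin at [z] in [E] exactly when it has a second point and misses round
    annuli centred at [z] of arbitrarily large modulus and arbitrarily small
    size ([thin_at_round], [round_thin_at]). Once this is known the theorem is
    a statement about distances to a point. A nonconstant analytic map [f] of
    local degree [p] at [y] satisfies
    [c1 * |w - y| ^ p <= |f w - f y| <= c2 * |w - y| ^ p] near [y], so a round
    gap of a compact set [K] around [y] becomes a round gap of [f @` K] around
    [f y] whose modulus is about [p] times larger ([finite_order_thin]).

    With [K] the closure of [J^(n)], the closure of [J] is the finite union of
    the images [F @` K] under the compositions [F] of the first [n - 1]
    families. The inclusion of [J] in this union holds because fibres of [F]
    are discrete: the preimages of a point at all the levels accumulate at a
    point to which infinitely many of them must be equal
    ([limit_set_preimage]), and finiteness of the family of compositions lets
    one map serve all the levels ([limit_set_finite_cover]). Given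
    [z = F y] in this union, [h_disjoint] keeps the other images away from [z],
    and [h_only] keeps away from [z] the images of the points of [K] that are far from
    [y]; near [z] only [F @` (K near y)] remains.

    The substance is [thick_annulus_round]: a conformal annulus of large modulus
    around [y] contains a round annulus centred at [y] of large modulus. Let
    [K0], which contains [y], and [K1] be the two components of the complement
    of the annulus [A]. If there is no such round annulus, then the distance
    from [y] to [K1] is at most [Q] times the largest distance from [y] to a
    point of [K0], and concentric squares can be found which all meet both [K0]
    and [K1]. Let [f] map [A] onto a round annulus of modulus [m]. The function
    [ln |f|], suitably clamped, extends continuously by constants across [K0]
    and [K1] ([annulus_potential]); it varies by at least [m / 2] along each of
    the squares. Summing the squares of these variations and applying
    Cauchy-Schwarz bounds [m ^ 2] by a multiple of the Dirichlet integral of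
    [ln |f|], which is the logarithmic area of the image and hence a multiple
    of [m]. So [m ^ 2 <= C * m], and [m] is bounded in terms of [Q].

    This length-area argument is carried out on a finite grid
    ([length_area_grid], [capacity_bound]). The oscillation of [ln |f|] over a
    small cell is comparable to the size of a square contained in the image of
    the cell, by strict differentiability of [f] with nonzero derivative
    ([injective_nearly_linear]); these squares are disjoint because [f] is
    injective, and disjoint squares in a dyadic shell have bounded total
    logarithmic area ([logarithmic_packing]). *)

Set Implicit Arguments.
Unset Strict Implicit.
Unset Printing Implicit Defensive.

(** * The modulus and the topology of the complex plane *)

Section Modulus.
Variable R : realType.
Local Notation C := (Cplx R).
Implicit Types (x y z w : C) (e r s t : R).

(** The norm of [Cplx R] is itself a complex number; inequalities are easier to
    state for its real part. *)
Definition nm z : R := complex.Re `|z|.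

Lemma nmE z : `|z| = (nm z)%:C%C.
Proof. by rewrite /nm normc_def. Qed.

Lemma nm_sqrt z : nm z = Num.sqrt (complex.Re z ^+ 2 + complex.Im z ^+ 2).
Proof. by rewrite /nm normc_def. Qed.

Lemma nm_ge0 z : 0 <= nm z.
Proof. by rewrite nm_sqrt sqrtr_ge0. Qed.

Lemma nm0 : nm 0 = 0. Proof. by rewrite /nm normr0. Qed.
Lemma nm1 : nm 1 = 1. Proof. by rewrite /nm normr1. Qed.

Lemma nm_eq0 z : (nm z == 0) = (z == 0).
Proof. by rewrite -[z == 0]normr_eq0 nmE eq_complex /= eqxx andbT. Qed.

Lemma nm_gt0 z : (0 < nm z) = (z != 0).
Proof. by rewrite lt_def nm_ge0 andbT nm_eq0. Qed.

Lemma nmM x y : nm (x * y) = nm x * nm y.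
Proof.
have : ((nm (x * y))%:C = (nm x * nm y)%:C)%C by rewrite rmorphM /= -!nmE normrM.
by move/complexI.
Qed.

Lemma nmN x : nm (- x) = nm x. Proof. by rewrite /nm normrN. Qed.
Lemma nmB x y : nm (x - y) = nm (y - x). Proof. by rewrite /nm distrC. Qed.

Lemma nmD x y : nm (x + y) <= nm x + nm y.
Proof. by have := ler_normD x y; rewrite !nmE -rmorphD lecR. Qed.

Lemma nmBD x y : nm (x - y) <= nm x + nm y.
Proof. by rewrite -(nmN y) nmD. Qed.

Lemma nm_tri x y z : nm (x - z) <= nm (x - y) + nm (y - z).
Proof. have -> : x - z = (x - y) + (y - z) by ring. exact: nmD. Qed.

Lemma nm_sub x y : nm x - nm y <= nm (x - y).
Proof. rewrite lerBlDr; have {1}-> : x = (x - y) + y by ring. exact: nmD. Qed.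

Lemma nmX x n : nm (x ^+ n) = nm x ^+ n.
Proof. by elim: n => [|n IH]; rewrite ?expr0 ?nm1 // !exprS nmM IH. Qed.

Lemma nmV x : nm (x^-1) = (nm x)^-1.
Proof.
have : ((nm (x^-1))%:C = ((nm x)^-1)%:C)%C by rewrite fmorphV /= -!nmE normfV.
by move/complexI.
Qed.

Lemma nm_sum (I : Type) (s : seq I) (P : pred I) (F : I -> C) :
  nm (\sum_(i <- s | P i) F i) <= \sum_(i <- s | P i) nm (F i).
Proof.
elim/big_rec2 : _ => [|i a b _ h]; first by rewrite nm0.
by apply: (le_trans (nmD _ _)); rewrite lerD2l.
Qed.

Lemma nm_real r : nm (r%:C%C) = `|r|.
Proof. by rewrite nm_sqrt /= expr0n addr0 sqrtr_sqr. Qed.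

Lemma nm_Re z : `|complex.Re z| <= nm z.
Proof. by rewrite nm_sqrt -sqrtr_sqr; apply: ler_wsqrtr; rewrite lerDl sqr_ge0. Qed.

Lemma nm_Im z : `|complex.Im z| <= nm z.
Proof. by rewrite nm_sqrt -sqrtr_sqr; apply: ler_wsqrtr; rewrite lerDr sqr_ge0. Qed.

Lemma nm_ReIm z : nm z <= `|complex.Re z| + `|complex.Im z|.
Proof.
rewrite nm_sqrt -[leRHS]ger0_norm ?addr_ge0 // -[leRHS]sqrtr_sqr.
apply: ler_wsqrtr; rewrite sqrrD !real_normK ?num_real //.
by rewrite lerD2r lerDl mulrn_wge0 // mulr_ge0.
Qed.

Lemma nbhs_nm z (P : set C) :
  nbhs z P <-> exists2 e, 0 < e & forall w, nm (w - z) < e -> P w.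
Proof.
split.
  move/nbhs_ballP => [e /= e0 h].
  have er : e = (complex.Re e)%:C%C by rewrite RRe_real // gtr0_real.
  exists (complex.Re e); first by rewrite -ltcR -er.
  move=> w hw; apply: h; rewrite -ball_normE /= distrC nmE er ltcR; exact: hw.
move=> [e e0 h]; apply/nbhs_ballP; exists (e%:C)%C; first by rewrite /= ltcR.
by move=> w; rewrite -ball_normE /= distrC nmE ltcR => /h.
Qed.

Lemma open_nm (A : set C) :
  open A <-> forall z, A z -> exists2 e, 0 < e & forall w, nm (w - z) < e -> A w.
Proof.
rewrite openE; split => [h z /h|h z Az]; first by move/nbhs_nm.
by apply/nbhs_nm; exact: h.
Qed.

Lemma cvg_nmP (f : C -> C) z (l : C) :
  (f w @[w --> z] --> l) <->
  (forall e, 0 < e -> exists2 d, 0 < d & forall w, nm (w - z) < d -> nm (f w - l) < e).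
Proof.
split => [h e e0|h].
  have : nbhs l [set w | nm (w - l) < e] by apply/nbhs_nm; exists e.
  by move/h => /nbhs_nm.
by move=> P /nbhs_nm[e e0 hP]; have [d d0 hd] := h _ e0; apply/nbhs_nm; exists d => // w /hd/hP.
Qed.

Lemma continuous_nm : continuous nm.
Proof.
move=> z P /nbhs_ballP[e /= e0 hP]; apply/nbhs_nm; exists e => // w hw.
apply: hP; rewrite -ball_normE /= distrC ltr_norml.
have := nm_sub w z; have := nm_sub z w; rewrite (nmB z w); lra.
Qed.

Lemma continuous_Re : continuous (fun z : C => complex.Re z).
Proof.
move=> z P /nbhs_ballP[e /= e0 hP]; apply/nbhs_nm; exists e => // w hw.
apply: hP; rewrite -ball_normE /= distrC; apply: le_lt_trans hw.
by rewrite -raddfB; exact: nm_Re.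
Qed.

Lemma continuous_Im : continuous (fun z : C => complex.Im z).
Proof.
move=> z P /nbhs_ballP[e /= e0 hP]; apply/nbhs_nm; exists e => // w hw.
apply: hP; rewrite -ball_normE /= distrC; apply: le_lt_trans hw.
by rewrite -raddfB; exact: nm_Im.
Qed.

Lemma continuous_Complex : continuous (fun p : R * R => (p.1 +i* p.2)%C : C).
Proof.
move=> [a b] P /nbhs_nm[e e0 hP].
have e2 : 0 < e / 2 by lra.
exists (ball a (e/2), ball b (e/2)); first by split; exact: nbhsx_ballx.
move=> [a' b'] /= [ha hb]; apply: hP.
move: ha hb; rewrite -!ball_normE /= => ha hb.
apply: le_lt_trans (nm_ReIm _) _ => /=; rewrite distrC (distrC b'); lra.
Qed.

Lemma compact_box (a b c d : R) :
  compact [set z : C | a <= complex.Re z <= b /\ c <= complex.Im z <= d].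
Proof.
have -> : [set z : C | a <= complex.Re z <= b /\ c <= complex.Im z <= d] =
    (fun p : R * R => (p.1 +i* p.2)%C : C) @` (`[a, b]%classic `*` `[c, d]%classic).
  apply/seteqP; split => [[x y] /= [h1 h2]|z [[x y] /= [h1 h2] <- //=]].
  by exists (x, y) => //=; rewrite !in_itv.
apply: continuous_compact; last by apply: compact_setX; exact: segment_compact.
by apply: continuous_subspaceT; exact: continuous_Complex.
Qed.

Lemma closed_le_nm z r : closed [set w : C | nm (w - z) <= r].
Proof.
rewrite -[X in closed X]setCK closedC; apply/open_nm => w /= /negP; rewrite -ltNge => h.
exists (nm (w - z) - r) => [|w' h']; first by rewrite subr_gt0.
apply/negP; rewrite -ltNge; have := nm_tri w w' z; rewrite (nmB w w'); lra.
Qed.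

Lemma hausdorff_C : hausdorff_space C.
Proof. exact: norm_hausdorff. Qed.

Lemma bounded_compact (A : set C) M :
  closed A -> (forall z, A z -> nm z <= M) -> compact A.
Proof.
move=> cA bA.
apply: (subclosed_compact cA (@compact_box (- M) M (- M) M)) => z /bA h /=.
by rewrite -!ler_norml !(le_trans (nm_Re _) h) !(le_trans (nm_Im _) h).
Qed.

Lemma compact_disc z r : compact [set w : C | nm (w - z) <= r].
Proof.
apply: (@bounded_compact _ (r + nm z)); first exact: closed_le_nm.
move=> w /= h; have := nm_sub w z; lra.
Qed.

Definition seg_pt (a b : C) (t : R) : C := a + t%:C%C * (b - a).

Lemma continuous_seg a b : continuous (seg_pt a b).
Proof.
move=> t P /nbhs_nm[e e0 hP]; apply/nbhs_ballP.
exists (e / (1 + nm (b - a))).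
  by rewrite /= divr_gt0 // ltr_wpDr ?nm_ge0.
move=> s; rewrite -ball_normE /= => hs; apply: hP.
have -> : seg_pt a b s - seg_pt a b t = (s - t)%:C%C * (b - a).
  by rewrite /seg_pt rmorphB /=; ring.
rewrite nmM nm_real distrC; have h := nm_ge0 (b - a).
rewrite ltr_pdivlMr in hs; last by lra.
by apply: le_lt_trans hs; rewrite ler_wpM2l //; lra.
Qed.

(** Segments are continuous images of the unit interval, and the set is the
    union of the segments issued from any of its points. *)
Lemma convex_connected (A : set C) :
  (forall a b t, A a -> A b -> 0 <= t <= 1 -> A (seg_pt a b t)) -> connected A.
Proof.
move=> hA; have [[a Aa]|] := pselect (A !=set0); last first.
  by move/set0P/negP; rewrite negbK => /eqP ->; exact: connected0.
have -> : A = \bigcup_(b in A) (seg_pt a b @` `[0, 1]%classic).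
  apply/seteqP; split => [b Ab|_ [b Ab [t /= t01 <-]]].
    by exists b => //; exists 1; rewrite /= ?in_itv /= ?lexx ?ler01 // /seg_pt; ring.
  by apply: hA => //; rewrite in_itv in t01.
apply: bigcup_connected.
  exists a => b Ab; exists 0; rewrite /= ?in_itv /= ?lexx ?ler01 // /seg_pt.
  by rewrite mul0r addr0.
move=> b Ab; apply: connected_continuous_connected; first exact: segment_connected.
by apply: continuous_subspaceT; exact: continuous_seg.
Qed.

End Modulus.

(** * Power series *)

Section PowerSeries.
Variable R : realType.
Local Notation C := (Cplx R).
Implicit Types (x y z w u v c : C) (e r s t rho K : R).

Lemma nm_subX u v k rho : nm u <= rho -> nm v <= rho ->
  nm (u ^+ k - v ^+ k) <= k%:R * rho ^+ k.-1 * nm (u - v).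
Proof.
move=> hu hv; rewrite subrXX nmM mulrC ler_wpM2r ?nm_ge0 //.
apply: le_trans (nm_sum _ _ _) _.
have rho0 := le_trans (nm_ge0 u) hu.
have -> : k%:R * rho ^+ k.-1 = \sum_(i < k) rho ^+ k.-1.
  by rewrite sumr_const card_ord mulr_natl.
apply: ler_sum => i _; rewrite nmM !nmX.
have -> : rho ^+ k.-1 = rho ^+ (k.-1 - i) * rho ^+ i.
  by rewrite -exprD subnK //; case: k i => [[]//|k] i /=; rewrite -ltnS.
by apply: ler_pM; rewrite ?exprn_ge0 ?nm_ge0 // lerXn2r ?nnegrE ?nm_ge0.
Qed.

Lemma cvg_terms_bounded (b : nat -> C) : cvgn (series b) ->
  exists2 B, 0 <= B & forall k, nm (b k) <= B.
Proof.
move=> /cvg_series_cvg_0 b0.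
have : cvgn b by apply/cvg_ex; exists 0.
move=> /cvg_seq_bounded[M [Mr hM]].
have M1 : M < M + 1 by rewrite ltrDl.
have h k : nm (b k) <= complex.Re (M + 1).
  by have := hM _ M1 k I; rewrite /= nmE lecE => /andP[_].
by exists (complex.Re (M + 1)) => //; exact: le_trans (nm_ge0 (b 0%N)) (h 0%N).
Qed.

(** The behaviour of [f] at [z] is that of the monomial [c * u ^+ p], up to an
    error that is small in the Lipschitz sense and not only in size: this
    single estimate gives the identity theorem, the local degree and, for
    [p = 1], strict differentiability. *)
Definition monomial_like (f : C -> C) z (p : nat) c K r :=
  [/\ (0 < p)%N, c != 0, 0 <= K, 0 < r &
    forall rho u v, rho <= r -> nm u <= rho -> nm v <= rho ->
    nm (f (z + u) - f (z + v) - c * (u ^+ p - v ^+ p))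
      <= K * rho ^+ p * nm (u - v)].

Definition locally_constant (f : C -> C) z := \forall w \near z, f w = f z.

(** With [rho <= s / 4] the terms beyond [p] decrease like [(1 / 4) ^+ m], and
    still like [(1 / 2) ^+ m] once multiplied by the factor [k <= p.+1 * 2 ^+ m]
    of [nm_subX]. The last factor is a partial sum of the resulting geometric
    series. *)
Lemma series_partial_bound (a : nat -> C) (p : nat) s B rho u v (m : nat) :
  (0 < p)%N -> (forall k, (0 < k < p)%N -> a k = 0) -> 0 < s ->
  (forall k, nm (a k) * s ^+ k <= B) ->
  rho <= s / 4 -> nm u <= rho -> nm v <= rho ->
  nm (series (fun k => a k * u ^+ k) (p.+1 + m)%N -
      series (fun k => a k * v ^+ k) (p.+1 + m)%N - a p * (u ^+ p - v ^+ p))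
   <= (p.+1%:R * B / s ^+ p.+1) * rho ^+ p * nm (u - v) * (2 - 2 * 2^-1 ^+ m).
Proof.
move=> p0 a0 s0 hB hr hu hv; have rho0 := le_trans (nm_ge0 u) hu.
have B0 : 0 <= B by apply: le_trans (hB 0%N); rewrite mulr_ge0 ?nm_ge0 // expr0.
have uv0 := nm_ge0 (u - v).
elim: m => [|m IH].
  have tail (w : C) : series (fun k => a k * w ^+ k) (p.+1 + 0)%N = a 0%N + a p * w ^+ p.
    rewrite addn0 /series /= big_nat_recr //= big_ltn // expr0 mulr1.
    rewrite big_nat_cond big1 ?addr0 // => k; rewrite andbT => hk.
    by rewrite a0 ?mul0r.
  rewrite !tail expr0.
  have -> : a 0%N + a p * u ^+ p - (a 0%N + a p * v ^+ p) - a p * (u ^+ p - v ^+ p) = 0.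
    by ring.
  by rewrite nm0 mulr1 subrr mulr0.
have rec (w : C) : series (fun k => a k * w ^+ k) (p.+1 + m.+1)%N =
   series (fun k => a k * w ^+ k) (p.+1 + m)%N + a (p.+1 + m)%N * w ^+ (p.+1 + m).
  by rewrite addnS /series /= big_nat_recr.
set k := (p.+1 + m)%N in IH rec *.
rewrite !rec; set S := series _ _ in IH *; set S' := series _ _ in IH *.
have -> : S + a k * u ^+ k - (S' + a k * v ^+ k) - a p * (u ^+ p - v ^+ p) =
  (S - S' - a p * (u ^+ p - v ^+ p)) + a k * (u ^+ k - v ^+ k) by ring.
apply: le_trans (nmD _ _) _.
have step : nm (a k * (u ^+ k - v ^+ k)) <=
    (p.+1%:R * B / s ^+ p.+1) * rho ^+ p * nm (u - v) * 2^-1 ^+ m.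
  rewrite nmM.
  have h1 : nm (a k) <= B / s ^+ k by rewrite ler_pdivlMr ?exprn_gt0.
  have h2 := nm_subX k hu hv.
  have h3 : rho ^+ m <= (s / 4) ^+ m by rewrite lerXn2r ?nnegrE //; lra.
  have h4 : (k%:R : R) <= p.+1%:R * 2 ^+ m.
    rewrite -natrX -natrM ler_nat /k.
    apply: (@leq_trans (p.+1 * m.+1)); first by rewrite mulnS leq_add2l leq_pmull.
    by rewrite leq_mul2l ltn_expl.
  have h5 : B / s ^+ k * (k%:R * rho ^+ k.-1 * nm (u - v)) <=
            B / s ^+ k * (p.+1%:R * 2 ^+ m * (rho ^+ p * (s / 4) ^+ m) * nm (u - v)).
    rewrite ler_wpM2l ?divr_ge0 ?exprn_ge0 ?(ltW s0) // ler_wpM2r //.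
    rewrite /k addSn /= exprD.
    apply: ler_pM; rewrite ?ler0n ?mulr_ge0 ?exprn_ge0 //.
    by rewrite ler_wpM2l ?exprn_ge0.
  apply: le_trans (ler_pM _ _ h1 h2) _; rewrite ?nm_ge0 //.
  apply: le_trans h5 _; rewrite le_eqVlt; apply/orP; left; apply/eqP.
  have -> : (s / 4) ^+ m = s ^+ m * 2^-1 ^+ m * 2^-1 ^+ m.
    by rewrite -exprMn -exprMn; congr (_ ^+ _); field.
  have -> : s ^+ k = s ^+ p.+1 * s ^+ m by rewrite -exprD.
  have e2 : (2 : R) ^+ m * 2^-1 ^+ m = 1 by rewrite -exprMn mulfV ?expr1n.
  have sp : s ^+ p.+1 != 0 by rewrite expf_neq0 // gt_eqF.
  have sm : s ^+ m != 0 by rewrite expf_neq0 // gt_eqF.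
  have -> : B / (s ^+ p.+1 * s ^+ m) * (p.+1%:R * 2 ^+ m *
     (rho ^+ p * (s ^+ m * 2^-1 ^+ m * 2^-1 ^+ m)) * nm (u - v)) =
     (2 ^+ m * 2^-1 ^+ m) * (B / (s ^+ p.+1 * s ^+ m) * (p.+1%:R *
     (rho ^+ p * (s ^+ m * 2^-1 ^+ m)) * nm (u - v))) by ring.
  rewrite e2 mul1r; move: (s ^+ p.+1) (s ^+ m) (2^-1 ^+ m) sp sm => X Y q sp sm.
  by field; rewrite sm sp.
apply: le_trans (lerD IH step) _; rewrite (exprS 2^-1).
rewrite le_eqVlt; apply/orP; left; apply/eqP.
by move: (_ / s ^+ p.+1) (2^-1 ^+ m) => X q; field.
Qed.

(** The degree [p] is the first positive index of a nonzero coefficient. The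
    coefficients are controlled by convergence at a single point at distance
    [s] from [z], and the bound on partial sums passes to the limit. *)
Lemma analytic_local (U : set C) (f : C -> C) z : analytic_on U f -> U z ->
  locally_constant f z \/
  exists (p : nat) c K r, monomial_like f z p c K r.
Proof.
move=> fan /fan[a /nbhs_nm[d d0 hd]].
have [ex|nex] := pselect (exists p, (0 < p)%N && (a p != 0)); last first.
  left; apply/nbhs_nm; exists d => //.
  have val w : nm (w - z) < d -> f w = a 0%N.
    move=> /hd cw; apply: (cvg_unique (@hausdorff_C R) cw).
    have cst : series (fun k => a k * (w - z) ^+ k) n @[n --> \oo] --> a 0%N; last exact: cst.
    apply: cvg_near_cst; exists 1%N => // n /= n1; rewrite /series /= big_ltn //.
    rewrite expr0 mulr1 big_nat_cond big1 ?addr0 // => k; rewrite andbT => /andP[k0 _].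
    have [->|ak] := eqVneq (a k) 0; first by rewrite mul0r.
    by case: nex; exists k; rewrite k0.
  by move=> w hw; rewrite !val // subrr nm0.
right; case: (ex_minnP ex) => p /andP[p0 ap] pmin.
pose s := d / 2; have s0 : 0 < s by rewrite divr_gt0.
have [B B0 hB] : exists2 B, 0 <= B & forall k, nm (a k) * s ^+ k <= B.
  have hs : nm (z + s%:C%C - z) < d.
    by rewrite addrC addKr nm_real gtr0_norm // /s; lra.
  have [|B B0 h] := @cvg_terms_bounded (fun k => a k * (s%:C%C) ^+ k).
    apply/cvg_ex; exists (f (z + s%:C%C)); have := hd _ hs.
    by rewrite [z + _]addrC addrK.
  by exists B => // k; have := h k; rewrite nmM nmX nm_real gtr0_norm.
exists p, (a p), (p.+1%:R * B / s ^+ p.+1 * 2), (s / 4); split => //.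
- by rewrite mulr_ge0 // divr_ge0 ?mulr_ge0 // exprn_ge0 // ltW.
- by rewrite divr_gt0.
move=> rho u v hr hu hv.
have sd (w : C) : nm w <= rho -> nm (z + w - z) < d.
  by move=> h; rewrite addrC addKr /s in hr *; lra.
have cu := hd _ (sd _ hu); have cv := hd _ (sd _ hv).
rewrite [z + u]addrC addrK [_ + z]addrC in cu; rewrite [z + v]addrC addrK [_ + z]addrC in cv.
set K := _ * 2 * rho ^+ p * _.
have cst : (fun _ : nat => a p * (u ^+ p - v ^+ p)) n @[n --> \oo] -->
    a p * (u ^+ p - v ^+ p) by exact: cvg_cst.
have cvD : series (fun k => a k * u ^+ k) n - series (fun k => a k * v ^+ k) n
    - a p * (u ^+ p - v ^+ p) @[n --> \oo] -->
    f (z + u) - f (z + v) - a p * (u ^+ p - v ^+ p).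
  by apply: (cvgB _ cst); exact: (cvgB cu cv).
suff : nm (f (z + u) - f (z + v) - a p * (u ^+ p - v ^+ p) - 0) <= K by rewrite subr0.
apply: (closed_cvg _ (@closed_le_nm R 0 K) _ _ cvD) => /=.
near=> n; rewrite subr0.
have -> : n = (p.+1 + (n - p.+1))%N by rewrite subnKC //; near: n; exists p.+1.
apply: le_trans (series_partial_bound _ p0 _ s0 hB hr hu hv) _.
  move=> k /andP[k0 kp]; apply/eqP; apply/negPn/negP => ak.
  by have := pmin k; rewrite k0 ak leqNgt kp => /(_ isT).
have rho0 := le_trans (nm_ge0 u) hu.
have Y0 : 0 <= p.+1%:R * B / s ^+ p.+1 * rho ^+ p * nm (u - v).
  by rewrite !mulr_ge0 ?invr_ge0 ?exprn_ge0 ?nm_ge0 // ltW.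
have -> : K = p.+1%:R * B / s ^+ p.+1 * rho ^+ p * nm (u - v) * 2 by rewrite /K; ring.
rewrite ler_wpM2l // gerBl mulr_ge0 // exprn_ge0 //.
Unshelve. all: by end_near. Qed.

End PowerSeries.

(** * Local degree and the identity theorem *)

Lemma connected_open_split (T : topologicalType) (A O1 O2 : set T) :
  connected A -> open O1 -> open O2 -> A `<=` O1 `|` O2 ->
  (forall x, A x -> O1 x -> O2 x -> False) -> A `<=` O1 \/ A `<=` O2.
Proof.
move=> cA o1 o2 AU dis; have [[x [Ax Ox]]|n1] := pselect (exists x, A x /\ O1 x).
  left; suff <- : A `&` O1 = A by move=> y [].
  apply: cA; [by exists x|by exists O1|].
  exists (~` O2); first by rewrite closedC.
  apply/seteqP; split => y [Ay h]; split => //; first by move=> /(dis _ Ay h).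
  by case: (AU _ Ay).
by right => x Ax; case: (AU _ Ax) => // Ox; case: n1; exists x.
Qed.

Section LocalTheory.
Variable R : realType.
Local Notation C := (Cplx R).
Implicit Types (x y z w u v c : C) (e r s t rho K : R).

(** What is left of analyticity once [f] is not locally constant and only
    distances matter: [p] is the local degree. Unlike nonconstancy, this
    property obviously passes to compositions. *)
Definition finite_order (f : C -> C) z := exists (p : nat) (c1 c2 r : R),
  [/\ (0 < p)%N, 0 < c1, 0 < c2, 0 < r &
    forall w, nm (w - z) < r ->
      c1 * nm (w - z) ^+ p <= nm (f w - f z) <= c2 * nm (w - z) ^+ p].

Lemma monomial_like_finite_order f z p c K r :
  monomial_like f z p c K r -> finite_order f z.
Proof.
move=> [p0 c0 K0 r0 h]; have nc : 0 < nm c by rewrite nm_gt0.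
have K1 : 0 < 2 * (K + 1) by lra.
pose d := Num.min r (nm c / (2 * (K + 1))).
exists p, (nm c / 2), (2 * nm c), d; split => //; try lra.
  by rewrite lt_min r0 divr_gt0.
move=> w; rewrite lt_min => /andP[hr hd].
have := h (nm (w - z)) (w - z) 0 (ltW hr) (lexx _).
rewrite nm0 nm_ge0 addr0 subr0 => /(_ isT).
have -> : z + (w - z) = w by ring.
rewrite expr0n eqn0Ngt p0 /= subr0.
set D := f w - f z; set n := nm (w - z) in hr hd *.
have n0 : 0 <= n by exact: nm_ge0.
have E : nm (c * (w - z) ^+ p) = nm c * n ^+ p by rewrite nmM nmX.
move=> hh; have := nm_sub D (c * (w - z) ^+ p); have := nm_sub (c * (w - z) ^+ p) D.
rewrite (nmB (c * _)) E.
have q0 : 0 <= n ^+ p by rewrite exprn_ge0.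
have hK : K * n <= nm c / 2.
  rewrite ltr_pdivlMr // in hd; nra.
have hK2 : K * n ^+ p * n <= nm c / 2 * n ^+ p.
  have -> : K * n ^+ p * n = (K * n) * n ^+ p by ring.
  by rewrite ler_wpM2r.
by move=> h1 h2; apply/andP; split; nra.
Qed.

Lemma finite_order_comp f g z :
  finite_order f z -> finite_order g (f z) -> finite_order (g \o f) z.
Proof.
move=> [p [c1 [c2 [r [p0 c10 c20 r0 hf]]]]] [q [d1 [d2 [s [q0 d10 d20 s0 hg]]]]].
exists (p * q)%N, (d1 * c1 ^+ q), (d2 * c2 ^+ q), (Num.min (Num.min r 1) (s / c2)).
split; rewrite ?muln_gt0 ?p0 ?q0 ?mulr_gt0 ?exprn_gt0 //.
  by rewrite !lt_min r0 ltr01 divr_gt0.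
move=> w; rewrite !lt_min => /andP[/andP[hr h1] hs].
have /andP[a1 a2] := hf _ hr.
have n0 := nm_ge0 (w - z).
have /hg/andP[b1 b2] : nm (f w - f z) < s.
  apply: le_lt_trans a2 _; rewrite mulrC -ltr_pdivlMr //.
  apply: le_lt_trans hs; rewrite -[leRHS]expr1.
  by apply: ler_wiXn2l => //; exact: ltW.
have m0 := nm_ge0 (f w - f z).
rewrite /= !exprM -!mulrA -!exprMn; apply/andP; split.
  apply: le_trans b1; rewrite ler_wpM2l ?(ltW d10) // lerXn2r ?nnegrE //.
  by rewrite mulr_ge0 ?exprn_ge0 // ltW.
apply: le_trans b2 _; rewrite ler_wpM2l ?(ltW d20) // lerXn2r ?nnegrE //.
by rewrite mulr_ge0 ?exprn_ge0 // ltW.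
Qed.

Lemma finite_order_id z : finite_order id z.
Proof.
by exists 1%N, 1, 1, 1; split => // w _; rewrite expr1 mul1r lexx.
Qed.

Lemma finite_order_isolated f z : finite_order f z ->
  \forall w \near z, f w = f z -> w = z.
Proof.
move=> [p [c1 [c2 [r [p0 c10 c20 r0 hf]]]]]; apply/nbhs_nm; exists r => // w /hf.
move=> /andP[h _] e; move: h; rewrite e subrr nm0 => h.
have [/eqP|n0] := eqVneq (nm (w - z)) 0; first by rewrite nm_eq0 subr_eq0 => /eqP.
by move: h; rewrite leNgt mulr_gt0 // exprn_gt0 // lt_def n0 nm_ge0.
Qed.

Lemma finite_order_continuous f z : finite_order f z -> {for z, continuous f}.
Proof.
move=> [p [c1 [c2 [r [p0 c10 c20 r0 hf]]]]]; apply/cvg_nmP => e e0.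
exists (Num.min (Num.min r 1) (e / c2)).
  by rewrite !lt_min r0 ltr01 divr_gt0.
move=> w; rewrite !lt_min => /andP[/andP[hr h1] he].
have /andP[_ a2] := hf _ hr.
apply: le_lt_trans a2 _; rewrite mulrC -ltr_pdivlMr //.
apply: le_lt_trans he; rewrite -[leRHS]expr1.
by apply: ler_wiXn2l; rewrite ?nm_ge0 // ltW.
Qed.

Lemma locally_constant_near f z : locally_constant f z ->
  \forall w \near z, locally_constant f w.
Proof.
move=> /nbhs_nm[d d0 h]; apply/nbhs_nm; exists (d / 2); first by lra.
move=> w hw; apply/nbhs_nm; exists (d / 2); first by lra.
move=> x hx; rewrite (h x) ?(h w) //; first by lra.
by have := nm_tri x w z; lra.
Qed.

(** Along the ray from [z] through a nearby point [w] the monomial moves at a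
    rate that beats the error term, so [f] cannot be constant near [w]. *)
Lemma monomial_like_not_constant f z p c K r : monomial_like f z p c K r ->
  \forall w \near z, ~ locally_constant f w.
Proof.
move=> ml; have [p0 c0 K0 r0 h] := ml; have nc : 0 < nm c by rewrite nm_gt0.
have K1 : 0 < K * 2 ^+ p + 1 by rewrite ltr_wpDl // mulr_ge0 ?exprn_ge0.
apply/nbhs_nm; exists (Num.min (r / 2) (nm c / (K * 2 ^+ p + 1))).
  by rewrite lt_min !divr_gt0.
move=> w; rewrite lt_min => /andP[wr wc].
have [->|wz] := eqVneq w z.
  move=> lc; have := finite_order_isolated (monomial_like_finite_order ml).
  move=> iso; have : nbhs z [set w | w = z] by near=> x; apply: (near iso x) => //; near: x.
  move=> /nbhs_nm[e e0 he].
  have : z + (e / 2)%:C%C = z.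
    apply: he; rewrite addrC addKr nm_real gtr0_norm; lra.
  move=> /(congr1 (fun x => x - z)); rewrite addrC addKr subrr => /complexI; lra.
move=> /nbhs_nm[e e0 he].
pose n := nm (w - z); have n0 : 0 < n by rewrite nm_gt0 subr_eq0.
pose t := Num.min 1 (e / (2 * n)).
have t0 : 0 < t by rewrite lt_min ltr01 divr_gt0 // mulr_gt0.
have t1 : t <= 1 by rewrite ge_min lexx.
have te : t * n <= e / 2.
  have : t <= e / (2 * n) by rewrite ge_min lexx orbT.
  rewrite ler_pdivlMr ?mulr_gt0 //; lra.
pose v := w - z; pose u := v + t%:C%C * v.
have uv : u - v = t%:C%C * v by rewrite /u; ring.
have nuv : nm (u - v) = t * n by rewrite uv nmM nm_real gtr0_norm.
have hu : nm u <= 2 * n.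
  by apply: le_trans (nmD _ _) _; rewrite nmM nm_real gtr0_norm // -/n; nra.
have hv : nm v <= 2 * n by rewrite -/n; lra.
have := h (2 * n) u v _ hu hv; rewrite nuv.
have fe : f (z + u) = f (z + v).
  have -> : z + v = w by rewrite /v; ring.
  apply: he; have -> : z + u - w = u - v by rewrite /v; ring.
  rewrite nuv; lra.
have -> : u ^+ p - v ^+ p = ((1 + t) ^+ p - 1)%:C%C * v ^+ p.
  rewrite /u -{1}[v]mul1r -mulrDl exprMn rmorphB rmorphXn rmorphD /= rmorph1; ring.
rewrite fe subrr sub0r nmN !nmM nmX -/n nm_real.
have pt : t <= (1 + t) ^+ p - 1.
  have : (1 + t) ^+ 1 <= (1 + t) ^+ p by apply: ler_weXn2l => //; lra.
  rewrite expr1; lra.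
rewrite ger0_norm; last by lra.
have np : 0 < n ^+ p by rewrite exprn_gt0.
rewrite exprMn; have -> : 2 * n <= r by rewrite -/n in wr; lra.
move=> /(_ isT); rewrite ltr_pdivlMr // -/n in wc.
have A : 0 < t * n ^+ p by rewrite mulr_gt0.
have B : nm c * (t * n ^+ p) <= nm c * (((1 + t) ^+ p - 1) * n ^+ p).
  by rewrite ler_wpM2l ?nm_ge0 // ler_wpM2r // ltW.
move=> /(le_trans B).
have -> : K * (2 ^+ p * n ^+ p) * (t * n) = (K * 2 ^+ p * n) * (t * n ^+ p) by ring.
rewrite ler_pM2r //; move: (2 ^+ p) wc => q wc; nra.
Unshelve. all: by end_near. Qed.

(** Identity theorem: in a connected domain the points near which [f] is
    constant form an open set, closed by [monomial_like_not_constant]. *)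
Lemma nonconstant_monomial_like (U : set C) f z :
  open U -> connected U -> analytic_on U f ->
  (exists x y, [/\ U x, U y & f x <> f y]) -> U z ->
  exists (p : nat) c K r, monomial_like f z p c K r.
Proof.
move=> oU cU fa [x [y [Ux Uy fxy]]] Uz.
have [lc|//] := analytic_local fa Uz; exfalso; apply: fxy.
have o1 : open (U `&` locally_constant f).
  rewrite openE => w [Uw lw]; near=> v; split.
    by near: v; move: oU; rewrite openE; apply.
  by near: v; exact: locally_constant_near.
have o2 : open (U `&` ~` locally_constant f).
  rewrite openE => w [Uw lw]; have [//|[p [c [K [r ml]]]]] := analytic_local fa Uw.
  near=> v; split; first by near: v; move: oU; rewrite openE; apply.
  by near: v; exact: (monomial_like_not_constant ml).
have [||hU|hU] := connected_open_split cU o1 o2.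
- by move=> w Uw; have [h|h] := pselect (locally_constant f w); [left|right].
- by move=> w _ [_ h] [_].
- have o3 : open (U `&` [set w | f w = f x]).
    rewrite openE => w [Uw lw]; near=> v; split.
      by near: v; move: oU; rewrite openE; apply.
    by rewrite /= -lw; near: v; exact: (hU _ Uw).2.
  have o4 : open (U `&` [set w | f w <> f x]).
    rewrite openE => w [Uw lw]; near=> v; split.
      by near: v; move: oU; rewrite openE; apply.
    rewrite /=; suff -> : f v = f w by [].
    by near: v; exact: (hU _ Uw).2.
  have [||hx|hx] := connected_open_split cU o3 o4.
  + by move=> w Uw; have [h|h] := pselect (f w = f x); [left|right].
  + by move=> w _ [_ h] [_].
  + by have [_ ->] := hx _ Uy.
  + by have [_ /(_ erefl)] := hx _ Ux.
- by have [_ /(_ lc)] := hU _ Uz.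
Unshelve. all: by end_near. Qed.

End LocalTheory.

(** * Injective analytic maps *)

Section Injective.
Variable R : realType.
Local Notation C := (Cplx R).
Implicit Types (x y z w u v c L : C) (e r s t rho K d : R).

(** On the closed disc of centre [z] and radius [rho], [f] is linear with
    multiplier [L] up to a quarter of [nm L]: the images of comparable discs
    are then comparable discs. *)
Definition nearly_linear (f : C -> C) z rho L := L != 0 /\
  forall u v, nm (u - z) <= rho -> nm (v - z) <= rho ->
    nm (f u - f v - L * (u - v)) <= nm L / 4 * nm (u - v).

Lemma nearly_linear_sub f z z' rho rho' L : nearly_linear f z rho L ->
  nm (z' - z) + rho' <= rho -> nearly_linear f z' rho' L.
Proof.
move=> [L0 h] hr; split => // u v hu hv; apply: h.
  by have := nm_tri u z' z; lra.
by have := nm_tri v z' z; lra.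
Qed.

Lemma nearly_linear_lipschitz f z rho L u v : nearly_linear f z rho L ->
  nm (u - z) <= rho -> nm (v - z) <= rho ->
  nm (f u - f v) <= 5 / 4 * nm L * nm (u - v).
Proof.
move=> [L0 h] hu hv; have := h _ _ hu hv; have := nm_sub (f u - f v) (L * (u - v)).
rewrite nmM; move: (nm (f u - f v)) (nm (f u - f v - _)) (nm L) (nm (u - v)) => a b l n h1 h2; lra.
Qed.

Lemma nearly_linear_expand f z rho L u v : nearly_linear f z rho L ->
  nm (u - z) <= rho -> nm (v - z) <= rho ->
  3 / 4 * nm L * nm (u - v) <= nm (f u - f v).
Proof.
move=> [L0 h] hu hv; have := h _ _ hu hv; have := nm_sub (L * (u - v)) (f u - f v).
rewrite nmM [leRHS]nmB; move: (nm (f u - f v)) (nm (f u - f v - _)) (nm L) (nm (u - v)) => a b l n h1 h2. lra.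
Qed.

(** The point of the disc where [nm (f u - w)] is least is interior, and one
    Newton step from it would divide this distance by four. *)
Lemma nearly_linear_surjective f z rho L w : 0 < rho -> nearly_linear f z rho L ->
  nm (w - f z) <= nm L * rho / 4 -> exists2 u, nm (u - z) <= rho & f u = w.
Proof.
move=> r0 nl hw; have [L0 h] := nl; have l0 : 0 < nm L by rewrite nm_gt0.
have zz : nm (z - z) <= rho by rewrite subrr nm0 ltW.
pose D := [set u | nm (u - z) <= rho].
have [|||u] := @compact_EVT_min C R (fun u => nm (f u - w)) D.
- by exists z.
- exact: compact_disc.
- apply/subspace_continuousP => x Dx P /nbhs_ballP[e /= e0 hP].
  apply/nbhs_nm; exists (e / (5 / 4 * nm L)); first by rewrite divr_gt0 //; lra.
  move=> y hy Dy; apply: hP; rewrite -ball_normE /=.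
  have := nearly_linear_lipschitz nl Dy Dx.
  rewrite ltr_pdivlMr in hy; last by lra.
  have := nm_tri (f y) (f x) w; have := nm_tri (f x) (f y) w; rewrite (nmB (f x) (f y)).
  by move=> h1 h2 h3; rewrite ltr_norml; apply/andP; split; lra.
- rewrite inE /D /= => uD umin.
have {}umin v : nm (v - z) <= rho -> nm (f u - w) <= nm (f v - w).
  by move=> hv; apply: umin; rewrite inE.
exists u => //.
apply/eqP; rewrite -subr_eq0 -nm_eq0 eq_le nm_ge0 andbT leNgt; apply/negP => m0.
pose v := u - (f u - w) / L.
have step : nm (v - u) = nm (f u - w) / nm L.
  have -> : v - u = - ((f u - w) / L) by rewrite /v; ring.
  by rewrite nmN nmM nmV.
have fz := umin z zz; rewrite (nmB (f z)) in fz.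
have vD : nm (v - z) <= rho.
  have e1 := nearly_linear_expand nl uD zz.
  have e2 := nm_tri (f u) w (f z).
  have e3 : nm (u - z) <= 2 / 3 * rho by rewrite -(ler_pM2l l0); lra.
  have e4 : nm (v - u) <= rho / 4 by rewrite step ler_pdivrMr //; lra.
  have := nm_tri v u z; lra.
have := h v u vD uD; rewrite step.
have -> : L * (v - u) = - (f u - w) by rewrite /v; field.
have -> : f v - f u - - (f u - w) = f v - w by ring.
have -> : nm L / 4 * (nm (f u - w) / nm L) = nm (f u - w) / 4.
  by field; rewrite gt_eqF.
have := umin v vD; lra.
Qed.

(** Algebraic closedness applied to [1 + 'X + ... + 'X^(p.-1)], which does not
    vanish at [1]. *)
Lemma nontrivial_root_of_unity p : (1 < p)%N ->
  exists2 w : C, w ^+ p = 1 & w != 1.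
Proof.
move=> p1; pose q : {poly C} := \poly_(i < p) 1.
have sq : size q = p by rewrite size_poly_eq // oner_neq0.
have [|w rw] := @closed_rootP C q _; first by rewrite sq; case: p p1 {q sq} => [|[]].
have sw : \sum_(i < p) w ^+ i = 0.
  move/rootP: rw; rewrite /q horner_poly => h; rewrite -[RHS]h.
  by apply: eq_bigr => i _; rewrite mul1r.
exists w.
  by apply/eqP; rewrite -subr_eq0 subrX1 sw mulr0.
apply/negP => /eqP w1; move: sw; rewrite w1 => /eqP.
under eq_bigr do rewrite expr1n.
by rewrite sumr_const card_ord pnatr_eq0; case: p p1 {q sq rw}.
Qed.

Lemma nm_mulX_near (o x y : C) (t : R) (a b : nat) : 0 <= t <= 1 -> nm o = 1 ->
  nm (x - o) <= t -> nm (y - o) <= t ->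
  nm (x ^+ a * y ^+ b - o ^+ (a + b)) <= (a + b)%:R * 2 ^+ (a + b) * t.
Proof.
move=> /andP[t0 t1] o1 hx hy.
have bd (z : C) : nm (z - o) <= t -> nm z <= 2.
  by move=> h; have := nm_sub z o; rewrite o1; lra.
have o2 : nm o <= 2 by rewrite o1; lra.
have pw (z : C) k : nm (z - o) <= t -> nm (z ^+ k - o ^+ k) <= k%:R * 2 ^+ k * t.
  move=> h; apply: le_trans (nm_subX k (bd _ h) o2) _.
  apply: ler_pM => //; rewrite ?mulr_ge0 ?exprn_ge0 ?nm_ge0 //.
  by rewrite ler_wpM2l // ler_weXn2l ?leq_pred //; lra.
have -> : x ^+ a * y ^+ b - o ^+ (a + b) =
    x ^+ a * (y ^+ b - o ^+ b) + o ^+ b * (x ^+ a - o ^+ a).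
  by rewrite exprD; ring.
apply: le_trans (nmD _ _) _; rewrite !nmM !nmX o1 expr1n mul1r natrD !mulrDl.
rewrite addrC lerD //.
  apply: le_trans (pw _ a hx) _; rewrite ler_wpM2r // ler_wpM2l // ler_weXn2l ?leq_addr //; lra.
have -> : b%:R * 2 ^+ (a + b) * t = 2 ^+ a * (b%:R * 2 ^+ b * t) by rewrite exprD; ring.
apply: ler_pM; rewrite ?exprn_ge0 ?nm_ge0 //; last exact: pw.
by rewrite lerXn2r ?nnegrE ?nm_ge0 //; apply: bd.
Qed.

(** Strict differentiability of [x ^+ p] at [o], with an explicit radius: the
    difference quotient is a sum of [p] monomials, each within
    [p * 2 ^+ p * t] of [o ^+ p.-1]. *)
Lemma nm_subX_near (o x y : C) (t : R) (p : nat) : 0 <= t <= 1 -> nm o = 1 ->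
  nm (x - o) <= t -> nm (y - o) <= t ->
  nm (x ^+ p - y ^+ p - p%:R * o ^+ p.-1 * (x - y))
    <= p%:R * (p%:R * 2 ^+ p * t) * nm (x - y).
Proof.
move=> t01 o1 hx hy; have /andP[t0 t1] := t01.
have -> : x ^+ p - y ^+ p - p%:R * o ^+ p.-1 * (x - y) =
   (x - y) * \sum_(i < p) (x ^+ (p.-1 - i) * y ^+ i - o ^+ p.-1).
  rewrite sumrB sumr_const card_ord subrXX -mulr_natl; ring.
rewrite nmM mulrC ler_wpM2r ?nm_ge0 //; apply: le_trans (nm_sum _ _ _) _.
have -> : p%:R * (p%:R * 2 ^+ p * t) = \sum_(i < p) (p%:R * 2 ^+ p * t) :> R.
  by rewrite sumr_const card_ord mulr_natl.
apply: ler_sum => i _.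
have e : p.-1 = (p.-1 - i + i)%N by rewrite subnK //; case: (p) i => [[]//|q] i; rewrite -ltnS.
rewrite {2}e; apply: le_trans (nm_mulX_near _ _ t01 o1 hx hy) _; rewrite -e.
rewrite ler_wpM2r //; apply: ler_pM; rewrite ?exprn_ge0 // ?ler_nat ?leq_pred //.
by rewrite ler_weXn2l ?leq_pred //; lra.
Qed.

(** If [f] were of degree [p > 1] at [z], then near [z] it would look like
    [u ^+ p], so the value taken at [z + s] would be taken again close to
    [z + s * q] for a root of unity [q] other than [1]. Rescaling by [s] turns
    this into [nearly_linear_surjective] on a fixed disc around [q]. *)
Lemma injective_degree1 f z p c K r d : monomial_like f z p c K r -> 0 < d ->
  (forall u v, nm (u - z) < d -> nm (v - z) < d -> f u = f v -> u = v) -> p = 1%N.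
Proof.
move=> [p0 c0 K0 r0 h] d0 inj; apply/eqP; rewrite eqn_leq p0 andbT leqNgt.
apply/negP => p1; have [q op o1] := nontrivial_root_of_unity p1.
have nc : 0 < nm c by rewrite nm_gt0.
have no : nm q = 1.
  apply/eqP; rewrite -(@eqrXn2 _ p) ?nm_ge0 //.
  by rewrite -nmX op nm1 expr1n.
have P0 : 0 < (p%:R : R) by rewrite ltr0n.
have Q0 : 0 < 8 * (p%:R * 2 ^+ p) :> R by rewrite !mulr_gt0 ?exprn_gt0.
(* On the disc of radius [k] around [q] the map [x ^+ p] is nearly linear, and
   the disc does not contain [1]. *)
pose k : R := Num.min (Num.min 1 (nm (q - 1) / 2)) (8 * (p%:R * 2 ^+ p))^-1.
have no1 : 0 < nm (q - 1) by rewrite nm_gt0 subr_eq0.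
have k0 : 0 < k by rewrite !lt_min ltr01 divr_gt0 // invr_gt0 Q0.
have k1 : k <= 1 by rewrite /k !ge_min lexx.
have k2 : k <= nm (q - 1) / 2 by rewrite /k !ge_min lexx orbT.
have k3 : p%:R * 2 ^+ p * k <= 1 / 8.
  have : k <= (8 * (p%:R * 2 ^+ p))^-1 by rewrite /k !ge_min lexx !orbT.
  by rewrite -[_^-1]mul1r ler_pdivlMr //; lra.
pose K' := K * 2 ^+ p / nm c.
have K'0 : 0 <= K' by rewrite !mulr_ge0 ?exprn_ge0 ?invr_ge0 ?nm_ge0.
have K'1 : 0 < 16 * (K' + 1) by lra.
(* At scale [s] the error term is at most a sixteenth of the multiplier [p],
   times [k]: enough for near linearity and for the distance of [F q] to [F 1]. *)
pose s := Num.min (Num.min (r / 2) (d / 4)) (p%:R * k / (16 * (K' + 1))).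
have s0 : 0 < s by rewrite !lt_min !divr_gt0 // mulr_gt0.
have s1 : s <= r / 2 by rewrite /s !ge_min lexx.
have s2 : s <= d / 4 by rewrite /s !ge_min lexx orbT.
have s3 : K' * s <= p%:R * k / 16.
  have : s <= p%:R * k / (16 * (K' + 1)) by rewrite /s !ge_min lexx !orbT.
  by rewrite ler_pdivlMr //; nra.
pose F (x : C) := (f (z + s%:C%C * x) - f z) / (c * s%:C%C ^+ p).
have sC : s%:C%C != 0 :> C by rewrite -nm_eq0 nm_real gtr0_norm // gt_eqF.
have FE x y : nm x <= 2 -> nm y <= 2 ->
    nm (F x - F y - (x ^+ p - y ^+ p)) <= K' * s * nm (x - y).
  move=> hx hy.
  have sn (w : C) : nm w <= 2 -> nm (s%:C%C * w) <= s * 2.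
    by move=> hw; rewrite nmM nm_real gtr0_norm // ler_wpM2l // ltW.
  have := h (s * 2) (s%:C%C * x) (s%:C%C * y) _ (sn _ hx) (sn _ hy).
  have -> : F x - F y - (x ^+ p - y ^+ p) =
    (f (z + s%:C%C * x) - f (z + s%:C%C * y)
      - c * ((s%:C%C * x) ^+ p - (s%:C%C * y) ^+ p)) / (c * s%:C%C ^+ p).
    rewrite /F !exprMn; field; rewrite c0 /= expf_neq0 //.
  rewrite nmM nmV nmM nmX nm_real gtr0_norm //.
  have sp : 0 < s ^+ p by rewrite exprn_gt0.
  rewrite ler_pdivrMr ?mulr_gt0 // -mulrBr nmM nm_real gtr0_norm //.
  have -> : K' * s * nm (x - y) * (nm c * s ^+ p) =
     K * (s * 2) ^+ p * (s * nm (x - y)).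
    by rewrite /K' exprMn; field; rewrite gt_eqF.
  by apply; lra.
have near2 x : nm (x - q) <= k -> nm x <= 2.
  by move=> hx; have := nm_sub x q; rewrite no; lra.
have Lp : nm (p%:R * q ^+ p.-1) = p%:R.
  by rewrite nmM nmX no expr1n mulr1 -(@rmorph_nat _ _ (real_complex R)) nm_real ger0_norm.
have NL : nearly_linear F q k (p%:R * q ^+ p.-1).
  split; first by rewrite -nm_eq0 Lp gt_eqF.
  move=> u v hu hv; rewrite Lp.
  have h1 := FE u v (near2 _ hu) (near2 _ hv).
  have h2 := @nm_subX_near q u v k p _ no hu hv.
  rewrite (ltW k0) k1 in h2; have {}h2 := h2 isT.
  have -> : F u - F v - p%:R * q ^+ p.-1 * (u - v) =
    (F u - F v - (u ^+ p - v ^+ p)) + (u ^+ p - v ^+ p - p%:R * q ^+ p.-1 * (u - v)) by ring.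
  apply: le_trans (nmD _ _) _; apply: le_trans (lerD h1 h2) _.
  rewrite -mulrDl ler_wpM2r ?nm_ge0 //.
  have : p%:R * (p%:R * 2 ^+ p * k) <= p%:R * (1 / 8) :> R by rewrite ler_pM2l.
  have : p%:R * k <= p%:R by rewrite -{2}[p%:R]mulr1 ler_pM2l.
  lra.
have [|x hx Fx] := nearly_linear_surjective k0 NL (w := F 1).
  rewrite Lp; have := @FE 1 q; rewrite nm1 no op expr1n subrr subr0.
  have := nmBD 1 q; rewrite nm1 no => h3 h4; apply: le_trans (h4 _ _) _; try lra.
  have h5 : nm (1 - q) <= 2 by lra.
  have h6 : 0 <= K' * s by rewrite mulr_ge0 // ltW.
  have := ler_pM h6 (nm_ge0 _) s3 h5; lra.
have cs : c * s%:C%C ^+ p != 0 by rewrite mulf_neq0 ?expf_neq0.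
have E : f (z + s%:C%C * x) = f (z + s%:C%C * 1).
  by move/(congr1 (fun y => y * (c * s%:C%C ^+ p))): Fx; rewrite /F !divfK // => /addIr.
have sd (w : C) : nm w <= 2 -> nm (z + s%:C%C * w - z) < d.
  move=> hw; rewrite addrC addKr nmM nm_real gtr0_norm //.
  have : s * nm w <= s * 2 by rewrite ler_pM2l.
  lra.
have {}E : x = 1.
  have := inj _ _ (sd _ (near2 _ hx)) (sd 1 _) E.
  rewrite nm1 => /(_ ltac:(lra))/addrI/(mulfI sC); apply.
by move: hx; rewrite E nmB; lra.
Qed.

Lemma injective_nearly_linear (A : set C) f z :
  open A -> analytic_on A f -> set_inj A f -> A z ->
  exists2 rho, 0 < rho & (forall w, nm (w - z) <= rho -> A w) /\
    exists L, nearly_linear f z rho L.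
Proof.
move=> oA fa inj Az; have /open_nm/(_ _ Az)[e e0 he] := oA.
have injd u v : nm (u - z) < e -> nm (v - z) < e -> f u = f v -> u = v.
  by move=> hu hv; apply: inj; rewrite inE; exact: he.
have [lc|[p [c [K [r ml]]]]] := analytic_local fa Az.
  move/nbhs_nm: lc => [d d0 hd].
  pose s := Num.min d e / 2.
  have s0 : 0 < s by rewrite divr_gt0 // lt_min d0.
  have sd : s < d by have : Num.min d e <= d by [rewrite ge_min lexx]; rewrite /s; lra.
  have se : s < e by have : Num.min d e <= e by [rewrite ge_min lexx orbT]; rewrite /s; lra.
  have hs : nm (z + s%:C%C - z) = s by rewrite addrC addKr nm_real gtr0_norm.
  have : z + s%:C%C = z.
    by apply: injd; rewrite ?hs ?subrr ?nm0 //; apply: hd; rewrite hs.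
  move=> /(congr1 (fun y => nm (y - z))); rewrite hs subrr nm0; lra.
have p1 := injective_degree1 ml e0 injd; move: ml; rewrite p1 => -[_ c0 K0 r0 h].
have nc : 0 < nm c by rewrite nm_gt0.
have K1 : 0 < 4 * (K + 1) by lra.
pose rho := Num.min (Num.min r (e / 2)) (nm c / (4 * (K + 1))).
have rho0 : 0 < rho by rewrite !lt_min r0 !divr_gt0.
have r1 : rho <= r by rewrite /rho !ge_min lexx.
have r2 : rho <= e / 2 by rewrite /rho !ge_min lexx orbT.
have r3 : K * rho <= nm c / 4.
  have : rho <= nm c / (4 * (K + 1)) by rewrite /rho !ge_min lexx !orbT.
  by rewrite ler_pdivlMr //; nra.
exists rho => //; split; first by move=> w hw; apply: he; lra.
exists c; split => // u v hu hv.
have := h rho (u - z) (v - z) r1 hu hv.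
have -> : z + (u - z) = u by ring.
have -> : z + (v - z) = v by ring.
rewrite !expr1; have -> : u - z - (v - z) = u - v by ring.
by move=> hh; apply: le_trans hh _; rewrite ler_wpM2r ?nm_ge0.
Qed.

End Injective.

(** * Packing squares *)

Section Packing.
Variable R : realType.

(** Additivity and monotonicity of the planar Lebesgue measure; all the lengths
    are half sides. *)
Lemma square_packing (I : finType) (P : pred I) (a b rho : I -> R) (B : R) :
  (forall i, P i -> 0 < rho i) ->
  (forall i j x y, P i -> P j -> `|x - a i| < rho i -> `|y - b i| < rho i ->
     `|x - a j| < rho j -> `|y - b j| < rho j -> i = j) ->
  (forall i x y, P i -> `|x - a i| < rho i -> `|y - b i| < rho i ->
     `|x| <= B /\ `|y| <= B) ->
  0 <= B -> \sum_(i | P i) rho i ^+ 2 <= B ^+ 2.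
Proof.
move=> r0 dis inB B0.
pose mu := @lebesgue_measure R.
pose m2 := (mu \x mu)%E.
pose S i : set (R * R) := `]a i - rho i, a i + rho i[%classic `*`
                          `]b i - rho i, b i + rho i[%classic.
pose Q : set (R * R) := `[- B, B]%classic `*` `[- B, B]%classic.
have itvE (c t x : R) : (x \in `]c - t, c + t[) = (`|x - c| < t).
  by rewrite in_itv /= ltr_distl.
have mS i : measurable (S i) by apply: measurableX; exact: measurable_itv.
have mQ : measurable Q by apply: measurableX; exact: measurable_itv.
have muS i : P i -> m2 (S i) = (4 * rho i ^+ 2)%:E.
  move=> Pi; have ri := r0 i Pi.
  pose J (c : R) : set R := `]c - rho i, c + rho i[%classic.
  have side (c : R) : lebesgue_measure (J c) = (2 * rho i)%:E.
    rewrite lebesgue_measure_itv /= lte_fin ifT; last by lra.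
    by rewrite -EFinD; congr (_%:E); ring.
  have -> : m2 (S i) = (lebesgue_measure (J (a i)) * lebesgue_measure (J (b i)))%E.
    by apply: product_measure1E; exact: measurable_itv.
  by rewrite !side -EFinM; congr (_%:E); ring.
have muQ : m2 Q = (4 * B ^+ 2)%:E.
  pose J : set R := `[- B, B]%classic.
  have side : lebesgue_measure J = (2 * B)%:E.
    rewrite lebesgue_measure_itv /= lte_fin.
    have [->|nB] := eqVneq B 0; first by rewrite oppr0 ltxx mulr0.
    have Bp : 0 < B by rewrite lt_def nB.
    by rewrite ifT; [rewrite -EFinD; congr (_%:E); ring | lra].
  have -> : m2 Q = (lebesgue_measure J * lebesgue_measure J)%E.
    by apply: product_measure1E; exact: measurable_itv.
  by rewrite !side -EFinM; congr (_%:E); ring.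
have fin : finite_set [set` P] by exact: finite_finset.
have tri : trivIset [set` P] S.
  move=> i j /= Pi Pj [[x y] [[/= xi yi] [/= xj yj]]].
  by apply: (dis i j x y) => //; rewrite -itvE.
have sub : \bigcup_(i in [set` P]) S i `<=` Q.
  move=> [x y] [i /= Pi [/= xi yi]].
  have [|| hx hy] := inB i x y Pi; rewrite -?itvE //.
  by split => /=; rewrite in_itv /= -ler_norml.
have : (m2 (\bigcup_(i in [set` P]) S i) <= m2 Q)%E.
  apply: le_measure => //; rewrite inE //.
  by apply: fin_bigcup_measurable => // i _; exact: mS.
have -> : m2 (\bigcup_(i in [set` P]) S i) = (\sum_(i \in [set` P]) m2 (S i))%E.
  by apply: measure_fin_bigcup => // i _; exact: mS.
rewrite muQ (fsbigE (enum P)) ?enum_uniq //; last 2 first.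
- by move=> i /=; rewrite mem_enum.
- by move=> i /= Pi; rewrite mem_enum [i \in P]Pi.
rewrite big_enum_cond /=.
rewrite (eq_bigr (fun i => (4 * rho i ^+ 2)%:E)); last first.
  by move=> i /andP[Pi _]; rewrite muS.
rewrite sumEFin lee_fin -mulr_sumr.
rewrite ler_pM2l // => h; apply: le_trans h; rewrite le_eqVlt; apply/orP; left.
apply/eqP; apply: eq_bigl => i; apply/idP/andP => [Pi|[]//]; split => //.
by rewrite inE.
Qed.

End Packing.

(** * The discrete length-area inequality *)

Section Grid.
Variable R : realType.
Local Notation C := (Cplx R).

Lemma sqr_sum_le (N : nat) (o : 'I_N -> R) :
  (\sum_(j < N) o j) ^+ 2 <= N%:R * \sum_(j < N) o j ^+ 2.
Proof.
have -> : (\sum_(j < N) o j) ^+ 2 = \sum_(i < N) \sum_(j < N) (o i * o j).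
  by rewrite expr2 big_distrlr.
have -> : N%:R * \sum_(j < N) o j ^+ 2 =
    \sum_(i < N) \sum_(j < N) ((o i ^+ 2 + o j ^+ 2) / 2).
  rewrite [RHS](eq_bigr (fun i => (N%:R * o i ^+ 2 + \sum_(j < N) o j ^+ 2) / 2)); last first.
    by move=> i _; rewrite -mulr_suml big_split /= sumr_const card_ord mulr_natl.
  rewrite -mulr_suml big_split /= -mulr_sumr sumr_const card_ord -mulr_natl.
  by field.
apply: ler_sum => i _; apply: ler_sum => j _.
have := sqr_ge0 (o i - o j); nra.
Qed.

Definition grid (T : R) (N k : nat) : R := - T + k%:R * (2 * T / N%:R).

Lemma grid0 T N : grid T N 0 = - T. Proof. by rewrite /grid mul0r addr0. Qed.

Lemma gridN T N : (0 < N)%N -> grid T N N = T.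
Proof. by move=> N0; rewrite /grid; field; rewrite pnatr_eq0 -lt0n. Qed.

Lemma grid_le T N k l : 0 <= T -> (k <= l)%N -> grid T N k <= grid T N l.
Proof.
by move=> T0 kl; rewrite lerD2l ler_wpM2r ?ler_nat // divr_ge0 // mulr_ge0.
Qed.

Lemma gridS T N k : grid T N k.+1 = grid T N k + 2 * T / N%:R.
Proof. by rewrite /grid -[k.+1]addn1 natrD; ring. Qed.

Lemma grid_sub T N k : (0 < N)%N -> (k <= N)%N -> grid T N (N - k) = - grid T N k.
Proof.
move=> N0 kN; rewrite /grid natrB //; field.
by rewrite pnatr_eq0 -lt0n.
Qed.

(** Clamping the grid between [y] and [y'] turns the oscillation over the
    interval into a telescoping sum of oscillations over single cells. *)
Lemma oscillation_le_sum (T : R) (N : nat) (w : R -> R) (o : 'I_N -> R) :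
  0 < T -> (0 < N)%N ->
  (forall (k : 'I_N) y y', grid T N k <= y <= grid T N k.+1 ->
     grid T N k <= y' <= grid T N k.+1 -> `|w y - w y'| <= o k) ->
  forall y y', - T <= y <= T -> - T <= y' <= T -> `|w y - w y'| <= \sum_(k < N) o k.
Proof.
move=> T0 N0 ho; have T0' := ltW T0.
suff H y y' : - T <= y -> y <= y' -> y' <= T -> `|w y - w y'| <= \sum_(k < N) o k.
  move=> y y' /andP[a b] /andP[a' b']; have [yy|/ltW yy] := leP y y'; first exact: H.
  by rewrite distrC; exact: H.
move=> hy yy hy'.
pose c k := Num.max y (Num.min (grid T N k) y').
have c0 : c 0%N = y.
  by rewrite /c grid0 max_l // ge_min hy.
have cN : c N = y' by rewrite /c gridN // min_r // max_r.
rewrite -c0 -cN distrC -(telescope_sumr (fun k => w (c k))) // big_mkord.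
apply: le_trans (ler_norm_sum _ _ _) _; apply: ler_sum => k _.
have gS := @grid_le T N k k.+1 T0' (leqnSn k).
have o0 : 0 <= o k.
  by apply: le_trans (ho k (grid T N k) (grid T N k) _ _); rewrite ?lexx ?gS.
have [h1|h1] := leP (grid T N k.+1) y.
  have e1 : c k.+1 = y by rewrite /c max_l // ge_min h1.
  have e2 : c k = y by rewrite /c max_l // ge_min (le_trans gS).
  by rewrite e1 e2 subrr normr0.
have [h2|h2] := leP y' (grid T N k).
  have e1 : c k.+1 = y' by rewrite /c min_r ?(le_trans h2) // max_r.
  have e2 : c k = y' by rewrite /c min_r // max_r.
  by rewrite e1 e2 subrr normr0.
by apply: ho; rewrite /c !le_max !ge_max !le_min !ge_min gS lexx ?(ltW h1) ?(ltW h2) ?yy ?orbT //= ?andbT.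
Qed.

Definition sup_norm (z : C) : R := Num.max `|complex.Re z| `|complex.Im z|.

(** The boundary of a square of half side
    [t] consists of pieces of two columns and two rows of the grid, so [v]
    cannot vary along it by more than twice the sum of the oscillations over
    these; Cauchy-Schwarz is then summed over [n] nested squares. *)
Lemma length_area_grid (T M : R) (q n : nat) (v : C -> R)
    (o : 'I_(q * n) -> 'I_(q * n) -> R) :
  0 < T -> (0 < q)%N -> (0 < n)%N -> 0 <= M ->
  (forall (i j : 'I_(q * n)) z w,
     grid T (q * n) i <= complex.Re z <= grid T (q * n) i.+1 ->
     grid T (q * n) j <= complex.Im z <= grid T (q * n) j.+1 ->
     grid T (q * n) i <= complex.Re w <= grid T (q * n) i.+1 ->
     grid T (q * n) j <= complex.Im w <= grid T (q * n) j.+1 ->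
     `|v z - v w| <= o i j) ->
  (forall l, (l < n)%N -> exists k0 k1,
     [/\ sup_norm k0 = - grid T (q * n) l, sup_norm k1 = - grid T (q * n) l &
         M <= `|v k0 - v k1|]) ->
  M ^+ 2 <= 64 * q%:R * \sum_i \sum_j o i j ^+ 2.
Proof.
set N := (q * n)%N => T0 q0 n0 M0 ho hk.
have N0 : (0 < N)%N by rewrite muln_gt0 q0.
have nN : (n <= N)%N by rewrite leq_pmull.
pose col i := \sum_j o i j; pose row j := \sum_i o i j.
have vert (i : 'I_N) x y y' : grid T N i <= x <= grid T N i.+1 ->
    - T <= y <= T -> - T <= y' <= T ->
    `|v (x +i* y)%C - v (x +i* y')%C| <= col i.
  move=> hx; apply: (oscillation_le_sum (w := fun y => v (x +i* y)%C)) => //.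
  by move=> k u u' hu hu'; apply: ho.
have hori (j : 'I_N) y x x' : grid T N j <= y <= grid T N j.+1 ->
    - T <= x <= T -> - T <= x' <= T ->
    `|v (x +i* y)%C - v (x' +i* y)%C| <= row j.
  move=> hy; apply: (oscillation_le_sum (w := fun x => v (x +i* y)%C)) => //.
  by move=> k u u' hu hu'; apply: ho.
have o0 i j : 0 <= o i j.
  have hi := @grid_le T N i i.+1 (ltW T0) (leqnSn i).
  have hj := @grid_le T N j j.+1 (ltW T0) (leqnSn j).
  by apply: le_trans (ho i j (grid T N i +i* grid T N j)%C (grid T N i +i* grid T N j)%C _ _ _ _);
    rewrite //= lexx.
have col0 i : 0 <= col i by apply: sumr_ge0.
have row0 j : 0 <= row j by apply: sumr_ge0.
pose S (l : 'I_N) := col l + col (rev_ord l) + (row l + row (rev_ord l)).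
have MS (l : 'I_N) : (l < n)%N -> M <= 2 * S l.
  move=> ln; have [k0 [k1 [s0 s1 Mk]]] := hk l ln.
  set t := - grid T N l in s0 s1.
  have tT : t <= T by rewrite /t lerNl -(grid0 T N) grid_le // ltW.
  have t0 : 0 <= t by rewrite -s0 /sup_norm le_max normr_ge0.
  have tb : - T <= t <= T by apply/andP; split; lra.
  have tb' : - T <= - t <= T by apply/andP; split; lra.
  have inl : grid T N l <= - t <= grid T N l.+1.
    by rewrite /t opprK lexx grid_le // ltW.
  have inr : grid T N (rev_ord l) <= t <= grid T N (rev_ord l).+1.
    rewrite /= -subSn // subSS /t -grid_sub ?(ltnW (ltn_ord l)) // lexx andbT.
    by apply: grid_le; [exact: ltW | rewrite leq_sub2l].
  have corner k : sup_norm k = t -> `|v k - v (t +i* t)%C| <= S l.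
    case: k => x y; rewrite /sup_norm /= => st.
    have xb : `|x| <= t by rewrite -st le_max lexx.
    have yb : `|y| <= t by rewrite -st le_max lexx orbT.
    have xb' : - T <= x <= T by rewrite -ler_norml; lra.
    have yb' : - T <= y <= T by rewrite -ler_norml; lra.
    have c1 := col0 l; have c2 := col0 (rev_ord l).
    have c3 := row0 l; have c4 := row0 (rev_ord l).
    have [xt|xt] : `|x| = t \/ `|y| = t.
      by move: st; case: (leP `|x| `|y|) => _ ->; [right|left].
    - have [xp|xn] := leP 0 x.
        rewrite ger0_norm // in xt; rewrite xt.
        by apply: le_trans (vert _ _ _ _ inr yb' tb) _; rewrite /S; lra.
      rewrite ltr0_norm // in xt; have -> : x = - t by lra.
      have h1 := vert _ _ _ _ inl yb' tb; have h2 := hori _ _ _ _ inr tb' tb.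
      apply: le_trans (ler_distD (v ((- t) +i* t)%C) _ _) _.
      apply: le_trans (lerD h1 h2) _; rewrite /S; lra.
    - have [xp|xn] := leP 0 y.
        rewrite ger0_norm // in xt; rewrite xt.
        by apply: le_trans (hori _ _ _ _ inr xb' tb) _; rewrite /S; lra.
      rewrite ltr0_norm // in xt; have -> : y = - t by lra.
      have h1 := hori _ _ _ _ inl xb' tb; have h2 := vert _ _ _ _ inr tb' tb.
      apply: le_trans (ler_distD (v (t +i* (- t))%C) _ _) _.
      apply: le_trans (lerD h1 h2) _; rewrite /S; lra.
  have h0 := corner _ s0; have h1 := corner _ s1.
  apply: le_trans Mk _; apply: le_trans (ler_distD (v (t +i* t)%C) _ _) _.
  by rewrite (distrC (v (t +i* t)%C)); lra.
have sq4 (a b c d : R) : (a + b + (c + d)) ^+ 2 <= 4 * (a ^+ 2 + b ^+ 2 + (c ^+ 2 + d ^+ 2)).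
  have := sqr_ge0 (a - b); have := sqr_ge0 (c - d); have := sqr_ge0 (a + b - (c + d)).
  nra.
have S2 : n%:R * M ^+ 2 <= \sum_(l < N) 4 * S l ^+ 2.
  have -> : n%:R * M ^+ 2 = \sum_(l < N | (l < n)%N) M ^+ 2.
    by rewrite -(big_ord_widen _ (fun _ => M ^+ 2) nN) sumr_const card_ord mulr_natl.
  rewrite [leRHS](bigID (fun l : 'I_N => (l < n)%N)) /= ler_wpDr ?sumr_ge0 //.
    by move=> l _; rewrite mulr_ge0 // sqr_ge0.
  apply: ler_sum => l ln; have -> : 4 * S l ^+ 2 = (2 * S l) ^+ 2 by ring.
  by have := MS l ln; nra.
have col2 : \sum_i col i ^+ 2 <= N%:R * \sum_i \sum_j o i j ^+ 2.
  by rewrite mulr_sumr; apply: ler_sum => i _; exact: sqr_sum_le.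
have row2 : \sum_j row j ^+ 2 <= N%:R * \sum_i \sum_j o i j ^+ 2.
  by rewrite exchange_big mulr_sumr; apply: ler_sum => j _; exact: sqr_sum_le.
have revs (F : 'I_N -> R) : \sum_i F (rev_ord i) = \sum_i F i.
  by rewrite [RHS](reindex_inj rev_ord_inj).
have : n%:R * M ^+ 2 <= n%:R * (64 * q%:R * \sum_i \sum_j o i j ^+ 2).
  apply: le_trans S2 _.
  apply: (@le_trans _ _ (\sum_(l < N) 16 * (col l ^+ 2 + col (rev_ord l) ^+ 2 +
     (row l ^+ 2 + row (rev_ord l) ^+ 2)))).
    by apply: ler_sum => l _; have := sq4 (col l) (col (rev_ord l)) (row l) (row (rev_ord l));
      rewrite -/(S l); lra.
  rewrite -mulr_sumr !big_split /= (revs (fun l => col l ^+ 2)) (revs (fun l => row l ^+ 2)).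
  move: col2 row2; rewrite /N natrM; set X := \sum_i \sum_j _; lra.
by rewrite ler_pM2l // ltr0n.
Qed.

End Grid.

(** * Logarithmic area and uniform linearity *)

Section Dirichlet.
Variable R : realType.
Local Notation C := (Cplx R).

(** In each dyadic shell the packing bound is scale invariant, so the total
    logarithmic area of the squares is at most proportional to the number of
    shells. *)
Lemma logarithmic_packing (I : finType) (G : pred I) (p : I -> C) (rho : I -> R)
    (r : R) (n : nat) :
  0 < r -> (forall i, G i -> 0 < rho i) ->
  (forall i, G i -> r <= nm (p i) < 2 ^+ n * r) ->
  (forall i j w, G i -> G j -> sup_norm (w - p i) < rho i ->
     sup_norm (w - p j) < rho j -> i = j) ->
  (forall i w, G i -> sup_norm (w - p i) < rho i -> nm w <= 2 * nm (p i)) ->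
  \sum_(i | G i) (rho i / nm (p i)) ^+ 2 <= 16 * n%:R.
Proof.
move=> r0 rho0 hp dis near.
pose shell i (m : nat) := 2 ^+ m * r <= nm (p i) < 2 ^+ m.+1 * r.
have sn (w : C) (a : R) : (sup_norm w < a) = (`|complex.Re w| < a) && (`|complex.Im w| < a).
  by rewrite /sup_norm gt_max.
have cover i : G i -> exists2 m, (m < n)%N & shell i m.
  move=> Gi; have /andP[h1 h2] := hp i Gi.
  elim: n h2 {hp} => [|n IH] h2; first by move: h2; rewrite expr0 mul1r ltNge h1.
  have [h3|h3] := ltP (nm (p i)) (2 ^+ n * r).
    by have [m mn sm] := IH h3; exists m => //; exact: leqW.
  by exists n => //; rewrite /shell h3.
have one (m : 'I_n) : \sum_(i | G i && shell i m) (rho i / nm (p i)) ^+ 2 <= 16.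
  have X0 : 0 < 2 ^+ m * r by rewrite mulr_gt0 // exprn_gt0.
  set X := 2 ^+ m * r in X0.
  have pack : \sum_(i | G i && shell i m) rho i ^+ 2 <= (4 * X) ^+ 2.
    apply: (@square_packing R I _ (fun i => complex.Re (p i)) (fun i => complex.Im (p i))).
    - by move=> i /andP[/rho0].
    - move=> i j x y /andP[Gi _] /andP[Gj _] a b c d.
      apply: (dis i j (x +i* y)%C Gi Gj); rewrite sn !raddfB /=.
        by rewrite a b.
      by rewrite c d.
    - move=> i x y /andP[Gi /andP[_ sm]] a b.
      have : nm (x +i* y)%C <= 2 * nm (p i).
        by apply: near Gi _; rewrite sn !raddfB /= a b.
      rewrite exprS -mulrA -/X in sm.
      have := nm_Re (x +i* y)%C; have := nm_Im (x +i* y)%C; rewrite /=.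
      by move=> h1 h2 h3; split; lra.
    - by rewrite mulr_ge0 // ltW.
  have -> : (16 : R) = (4 * X) ^+ 2 / X ^+ 2 by field; rewrite gt_eqF.
  rewrite ler_pdivlMr ?exprn_gt0 // mulr_suml; apply: le_trans pack.
  apply: ler_sum => i /andP[Gi /andP[sm _]]; rewrite -/X in sm.
  have pX : 0 < nm (p i) by lra.
  have -> : (rho i / nm (p i)) ^+ 2 * X ^+ 2 = rho i ^+ 2 * (X / nm (p i)) ^+ 2.
    by field; rewrite gt_eqF.
  rewrite ler_piMr ?sqr_ge0 // expr_le1 // ?ler_pdivrMr ?mul1r //.
  by rewrite divr_ge0 // ltW.
have -> : 16 * n%:R = \sum_(m < n) (16 : R) by rewrite sumr_const card_ord mulr_natr.
apply: (@le_trans _ _ (\sum_(m < n) \sum_(i | G i && shell i m) (rho i / nm (p i)) ^+ 2)).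
  under [leRHS]eq_bigr do rewrite big_mkcondr /=.
  rewrite exchange_big /=; apply: ler_sum => i Gi.
  have [m mn sm] := cover i Gi.
  rewrite (bigD1 (Ordinal mn)) //= sm ler_wpDr // sumr_ge0 // => k _.
  by case: ifP => // _; rewrite sqr_ge0.
by apply: ler_sum => m _; exact: one.
Qed.

Definition good_disc (A : set C) (f : C -> C) (e : R) (d : R) (z : C) :=
  [/\ forall w, nm (w - z) <= d -> A w,
      exists L, nearly_linear f z d L &
      forall w, nm (w - z) <= d -> nm (f w - f z) <= e].

(** Compactness makes the size of the discs of near linearity uniform, because
    the multiplier found at [x] serves all the smaller discs close to [x]. *)
Lemma uniform_good_disc (A K : set C) (f : C -> C) (e : R) :
  compact K -> K `<=` A -> 0 < e ->
  (forall z, A z -> exists2 rho, 0 < rho & (forall w, nm (w - z) <= rho -> A w) /\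
     exists L, nearly_linear f z rho L) ->
  exists2 d, 0 < d & forall z, K z -> good_disc A f e d z.
Proof.
move=> cK KA e0 loc.
have /compact_near_coveringP cov := cK.
have H : \forall d \near (0 : R)^'+, K `<=` good_disc A f e d.
  apply: (cov R (0 : R)^'+ (good_disc A f e)) => x Kx; have [rho rho0 [hA [L nl]]] := loc x (KA _ Kx).
  have L0 : 0 < nm L by rewrite nm_gt0; case: nl.
  pose s := Num.min (rho / 2) (e / (5 / 4 * nm L)).
  have s0 : 0 < s by rewrite lt_min !divr_gt0 // mulr_gt0.
  have s1 : s <= rho / 2 by rewrite /s ge_min lexx.
  have s2 : 5 / 4 * nm L * s <= e.
    have : s <= e / (5 / 4 * nm L) by rewrite /s ge_min lexx orbT.
    by rewrite ler_pdivlMr ?mulr_gt0 // mulrC.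
  exists ([set z | nm (z - x) < s], [set d | d <= s]).
    by split => /=; [apply/nbhs_nm; exists s | exact: nbhs_right_le].
  move=> [z d] /= [hz hd]; split.
  - by move=> w hw; apply: hA; have := nm_tri w z x; lra.
  - by exists L; apply: nearly_linear_sub nl _; lra.
  - move=> w hw; have d0 := le_trans (nm_ge0 _) hw.
    have hw' : nm (w - x) <= rho by have := nm_tri w z x; lra.
    have hz' : nm (z - x) <= rho by lra.
    apply: le_trans (nearly_linear_lipschitz nl hw' hz') _; apply: le_trans s2.
    by rewrite ler_wpM2l ?mulr_ge0 ?nm_ge0 //; lra.
have [d [d0 hd]] := @filter_ex _ (at_right (0 : R)) _ _ (filterI (nbhs_right_gt (0 : R)) H).
by exists d.
Qed.

End Dirichlet.

(** * The capacity bound *)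

Section Capacity.
Variable R : realType.
Local Notation C := (Cplx R).

Definition cell (T : R) (N : nat) (ij : 'I_N * 'I_N) : set C :=
  [set z | grid T N ij.1 <= complex.Re z <= grid T N ij.1.+1 /\
           grid T N ij.2 <= complex.Im z <= grid T N ij.2.+1].

Definition cell_center (T : R) (N : nat) (ij : 'I_N * 'I_N) : C :=
  ((grid T N ij.1 + T / N%:R) +i* (grid T N ij.2 + T / N%:R))%C.

Lemma cell_center_in T N ij : 0 <= T -> cell T ij (cell_center T (N := N) ij).
Proof.
move=> T0; have h0 : 0 <= T / N%:R by rewrite divr_ge0.
by rewrite /cell /cell_center /= !gridS; split; apply/andP; split; lra.
Qed.

Lemma cell_diam T N (ij : 'I_N * 'I_N) z w : cell T ij z -> cell T ij w ->
  nm (z - w) <= 4 * (T / N%:R).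
Proof.
move=> [/andP[a b] /andP[c d]] [/andP[a' b'] /andP[c' d']].
rewrite !gridS in b b' d d'.
apply: le_trans (nm_ReIm _) _; rewrite !raddfB /=.
have : `|complex.Re z - complex.Re w| <= 2 * (T / N%:R).
  by rewrite ler_norml; apply/andP; split; lra.
have : `|complex.Im z - complex.Im w| <= 2 * (T / N%:R).
  by rewrite ler_norml; apply/andP; split; lra.
lra.
Qed.

Lemma cell_connected T N (ij : 'I_N * 'I_N) : connected (cell T ij).
Proof.
apply: convex_connected => a b t [/andP[a1 a2] /andP[a3 a4]] [/andP[b1 b2] /andP[b3 b4]].
move=> /andP[t0 t1]; rewrite /cell /seg_pt /=.
have -> : complex.Re (a + t%:C%C * (b - a)) = complex.Re a + t * (complex.Re b - complex.Re a).
  by case: a {a1 a2 a3 a4} => ? ?; case: b {b1 b2 b3 b4} => ? ? /=; ring.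
have -> : complex.Im (a + t%:C%C * (b - a)) = complex.Im a + t * (complex.Im b - complex.Im a).
  by case: a {a1 a2 a3 a4} => ? ?; case: b {b1 b2 b3 b4} => ? ? /=; ring.
by split; apply/andP; split; nra.
Qed.

Lemma cell_center_inj T N (ij kl : 'I_N * 'I_N) : 0 < T -> (0 < N)%N ->
  nm (cell_center T ij - cell_center T kl) < 2 * (T / N%:R) -> ij = kl.
Proof.
move=> T0 N0 h; have h0 : 0 < 2 * T / N%:R by rewrite divr_gt0 ?mulr_gt0 // ltr0n.
have aux (i j : 'I_N) : `|grid T N i - grid T N j| < 2 * (T / N%:R) -> i = j.
  move=> hij; apply/val_inj/eqP; rewrite /= eqn_leq; apply/andP; split;
    rewrite leqNgt; apply/negP => lt; move: hij; rewrite ltNge => /negP; apply.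
  - have := @grid_le R T N j.+1 i (ltW T0) lt; rewrite gridS => h1.
    by rewrite ger0_norm; lra.
  - have := @grid_le R T N i.+1 j (ltW T0) lt; rewrite gridS => h1.
    by rewrite ler0_norm; lra.
have hr := nm_Re (cell_center T ij - cell_center T kl).
have hi := nm_Im (cell_center T ij - cell_center T kl).
rewrite !raddfB /cell_center /= in hr hi h.
have e (a b c : R) : a + c - (b + c) = a - b by ring.
rewrite !e in hr hi h.
rewrite [ij]surjective_pairing [kl]surjective_pairing.
by congr pair; apply: aux; [apply: le_lt_trans hr _ | apply: le_lt_trans hi _].
Qed.

(** A cell of half side [h] which meets a good disc is mapped almost linearly,
    with multiplier [L]. Its image has diameter at most [5 * nm L * h], and
    contains the square of half side [rho = nm L * h / 16] around the image of
    the centre. That square is already covered by the points at distance less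
    than [h] from the centre, which belong to no other cell. *)
Lemma cell_estimate (A : set C) f (r d T : R) N (ij : 'I_N * 'I_N) z :
  0 < T -> (0 < N)%N -> 0 < r ->
  (forall z, A z -> r <= nm (f z)) -> 8 * (T / N%:R) <= d ->
  good_disc A f (r / 4) d z -> cell T ij z ->
  exists rho : R,
  [/\ 0 < rho, A (cell_center T ij),
      forall w, sup_norm (w - f (cell_center T ij)) < rho -> exists u,
        [/\ nm (u - cell_center T ij) < T / N%:R, A u, f u = w &
            nm w <= 2 * nm (f (cell_center T ij))] &
      forall u, cell T ij u ->
        [/\ A u, nm (f (cell_center T ij)) / 2 <= nm (f u) &
         forall w, cell T ij w -> nm (f u - f w) <= 80 * rho]].
Proof.
set h := T / N%:R; set p := cell_center T ij.
move=> T0 N0 r0 fr hd [zA [L nl] zf] cz.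
have h0 : 0 < h by rewrite divr_gt0 // ltr0n.
have cp : cell T ij p by apply: cell_center_in; exact: ltW.
have inD u : cell T ij u -> nm (u - z) <= d.
  by move=> cu; have := cell_diam cu cz; rewrite -/h; lra.
have L0 : 0 < nm L by rewrite nm_gt0; case: nl.
have Ap : A p by apply: zA; exact: inD.
have fp := fr p Ap.
have nlp : nearly_linear f p (h / 2) L.
  by apply: nearly_linear_sub nl _; have := cell_diam cp cz; rewrite -/h; lra.
have fpp u : nm (u - p) <= 4 * h -> nm (f u - f p) <= r / 2.
  move=> hu; have pz := zf _ (inD _ cp).
  have uz : nm (u - z) <= d.
    by have := cell_diam cp cz; have := nm_tri u p z; rewrite -/h; lra.
  by have := zf _ uz; have := nm_tri (f u) (f z) (f p); rewrite (nmB (f z)); lra.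
exists (nm L * h / 16); split => //.
- by rewrite divr_gt0 // mulr_gt0.
- move=> w sw.
  have wp : nm (w - f p) <= nm L * (h / 2) / 4.
    apply: le_trans (nm_ReIm _) _; move: sw; rewrite /sup_norm gt_max => /andP[].
    lra.
  have h2 : 0 < h / 2 by lra.
  have [u hu fu] := nearly_linear_surjective h2 nlp wp.
  have uz : nm (u - z) <= d.
    by have := cell_diam cp cz; have := nm_tri u p z; rewrite -/h; lra.
  exists u; split => //; [lra | exact: zA |].
  have : nm (f u - f p) <= r / 2 by apply: fpp; lra.
  by rewrite fu; have := nm_sub w (f p); lra.
move=> u cu; split; first by apply: zA; exact: inD.
  have up : nm (u - p) <= 4 * h by exact: (cell_diam cu cp).
  by have := fpp u up; have := nm_sub (f p) (f u); rewrite (nmB (f p)); lra.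
move=> w cw.
apply: le_trans (nearly_linear_lipschitz nl (inD _ cu) (inD _ cw)) _.
have := cell_diam cu cw; rewrite -/h => huw.
have : 5 / 4 * nm L * nm (u - w) <= 5 / 4 * nm L * (4 * h).
  by rewrite ler_wpM2l // mulr_ge0 // ltW.
lra.
Qed.

Lemma constant_on_connected (T : eqType) (S : set C) (v : C -> T) :
  connected S -> (forall z, S z -> \forall w \near z, v w = v z) ->
  forall z w, S z -> S w -> v z = v w.
Proof.
move=> cS lc z w Sz Sw.
have o1 : open [set x | (\forall y \near x, v y = v x) /\ v x = v z].
  rewrite openE => x [/= lx xz].
  have /nbhs_nm[e e0 he] := lx; apply/nbhs_nm; exists (e / 2); first by lra.
  move=> y hy; have hyx : v y = v x by apply: he; lra.
  split; last by rewrite /= hyx.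
  apply/nbhs_nm; exists (e / 2); first by lra.
  by move=> u hu; rewrite hyx; apply: he; have := nm_tri u y x; lra.
have o2 : open [set x | (\forall y \near x, v y = v x) /\ v x <> v z].
  rewrite openE => x [/= lx xz].
  have /nbhs_nm[e e0 he] := lx; apply/nbhs_nm; exists (e / 2); first by lra.
  move=> y hy; have hyx : v y = v x by apply: he; lra.
  split; last by rewrite /= hyx.
  apply/nbhs_nm; exists (e / 2); first by lra.
  by move=> u hu; rewrite hyx; apply: he; have := nm_tri u y x; lra.
have [||h|h] := connected_open_split cS o1 o2.
- by move=> x Sx; have [e|e] := eqVneq (v x) (v z); [left|right]; split; [exact: lc| |exact: lc| exact/eqP].
- by move=> x _ [_ a] [_].
- by have [_ ->] := h _ Sw.
- by have [_ /(_ erefl)] := h _ Sz.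
Qed.

(** If [v], which is Lipschitz for the metric [|dw| / |w|] in the image of [f]
    and locally constant away from a compact part of [A], jumps by [M] along all
    the square curves of half side between [T - 2 * T / q] and [T], then [M ^+ 2]
    is bounded by the number [P] of dyadic shells containing the image. Only the
    cells meeting [K] contribute; [160 * (rho / nm p)] bounds the oscillation of
    [v] over such a cell, as the modulus of [f] is there at least half of the
    modulus of the image [p] of its centre. *)
Lemma capacity_bound (A K : set C) (f : C -> C) (v : C -> R) (r T M : R) (P q : nat) :
  compact K -> K `<=` A -> 0 < r ->
  (forall z, A z -> r <= nm (f z) < 2 ^+ P * r) -> set_inj A f ->
  (forall z, A z -> exists2 rho, 0 < rho & (forall w, nm (w - z) <= rho -> A w) /\
     exists L, nearly_linear f z rho L) ->
  (forall z w m, A z -> A w -> 0 < m -> m <= nm (f z) -> m <= nm (f w) ->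
     `|v z - v w| <= nm (f z - f w) / m) ->
  (forall z, ~ K z -> \forall w \near z, v w = v z) ->
  0 < T -> (0 < q)%N -> 0 <= M ->
  (forall t, T - 2 * T / q%:R <= t <= T -> exists k0 k1,
     [/\ sup_norm k0 = t, sup_norm k1 = t & M <= `|v k0 - v k1|]) ->
  M ^+ 2 <= 64 * q%:R * (160 ^+ 2 * (16 * P%:R)).
Proof.
move=> cK KA r0 fr finj loc vlip vloc T0 q0 M0 cross.
have r4 : 0 < r / 4 by rewrite divr_gt0.
have [d d0 gd] := uniform_good_disc cK KA r4 loc.
have [n n0 hn] : exists2 n, (0 < n)%N & 8 * (T / (q * n)%:R) <= d.
  have Q0 : 0 < q%:R :> R by rewrite ltr0n.
  have x0 : 0 <= 8 * T / (q%:R * d) by rewrite divr_ge0 // ?mulr_ge0 // ltW.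
  exists (Num.bound (8 * T / (q%:R * d))).+1 => //.
  have := archi_boundP x0; set b := Num.bound _ => hb.
  have hb' : 8 * T / (q%:R * d) <= b.+1%:R.
    by apply: le_trans (ltW hb) _; rewrite ler_nat.
  rewrite ler_pdivrMr ?mulr_gt0 // in hb'.
  rewrite natrM mulrA ler_pdivrMr ?mulr_gt0 // ?ltr0n //; nra.
set N := (q * n)%N in hn.
have N0 : (0 < N)%N by rewrite muln_gt0 q0.
pose G (ij : 'I_N * 'I_N) := `[< exists2 z, K z & cell T ij z >].
have fr1 z : A z -> r <= nm (f z) by move=> /fr/andP[].
have : forall ij : 'I_N * 'I_N, exists rho : R, G ij ->
  [/\ 0 < rho, A (cell_center T ij),
      forall w, sup_norm (w - f (cell_center T ij)) < rho -> exists u,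
        [/\ nm (u - cell_center T ij) < T / N%:R, A u, f u = w &
            nm w <= 2 * nm (f (cell_center T ij))] &
      forall u, cell T ij u ->
        [/\ A u, nm (f (cell_center T ij)) / 2 <= nm (f u) &
         forall w, cell T ij w -> nm (f u - f w) <= 80 * rho]].
  move=> ij; have [/asboolP[z Kz cz]|nG] := boolP (G ij); last by exists 0.
  have [rho hrho] := cell_estimate T0 N0 r0 fr1 hn (gd z Kz) cz.
  by exists rho.
move=> /choice[rho Hrho].
pose p ij := f (cell_center T (N := N) ij).
pose o i j := if G (i, j) then 160 * (rho (i, j) / nm (p (i, j))) else 0.
have fp ij : G ij -> 0 < nm (p ij).
  by move=> /Hrho[_ Ap _ _]; apply: lt_le_trans r0 _; exact: fr1.
have := @length_area_grid R T M q n v o T0 q0 n0 M0 _ _.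
move=> /(_ _ _)/le_trans; apply.
- move=> i j z w z1 z2 w1 w2; rewrite /o -/N.
  have cz : cell T (i, j) z by [].
  have cw : cell T (i, j) w by [].
  case: ifPn => [Gij|/asboolPn nG].
    have [rp Ap _ hc] := Hrho _ Gij.
    have [Az fz fzw] := hc z cz; have [Aw fw _] := hc w cw.
    have m0 : 0 < nm (p (i, j)) / 2 by rewrite divr_gt0 // fp.
    apply: le_trans (vlip z w _ Az Aw m0 fz fw) _.
    have -> : 160 * (rho (i, j) / nm (p (i, j))) = 80 * rho (i, j) / (nm (p (i, j)) / 2).
      by field; rewrite gt_eqF // fp.
    by rewrite ler_pM2r ?invr_gt0 // fzw.
  rewrite (constant_on_connected (@cell_connected T N (i, j)) _ cz cw) ?subrr ?normr0 //.
  by move=> u cu; apply: vloc => Ku; apply: nG; exists u.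
- move=> l ln; have [|k0 [k1 [s0 s1 Mk]]] := cross (- grid T N l).
    have l0 : 0 <= l%:R :> R by [].
    have lN : l%:R <= n%:R :> R by rewrite ler_nat ltnW.
    have Q0 : 0 < q%:R :> R by rewrite ltr0n.
    have n00 : 0 < n%:R :> R by rewrite ltr0n.
    have h1 : 0 <= l%:R * (2 * T / N%:R) by rewrite mulr_ge0 // divr_ge0 // mulr_ge0 // ltW.
    have h2 : l%:R * (2 * T / N%:R) <= n%:R * (2 * T / N%:R).
      by rewrite ler_wpM2r // divr_ge0 // mulr_ge0 // ltW.
    have h3 : n%:R * (2 * T / N%:R) = 2 * T / q%:R.
      by rewrite /N natrM; field; rewrite !gt_eqF.
    by rewrite /grid; lra.
  by exists k0, k1.
rewrite ler_wpM2l ?mulr_ge0 //.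
have -> : \sum_i \sum_j o i j ^+ 2 =
    160 ^+ 2 * \sum_(ij | G ij) (rho ij / nm (p ij)) ^+ 2.
  rewrite pair_big /= mulr_sumr [RHS]big_mkcond /=; apply: eq_bigr => -[i j] _.
  by rewrite /o /=; case: ifP => _; [ring | rewrite expr0n].
rewrite ler_wpM2l //; apply: (logarithmic_packing r0).
- by move=> ij /Hrho[].
- by move=> ij /Hrho[_ Ap _ _]; exact: fr.
- move=> ij kl w Gij Gkl wi wk.
  have [_ _ hi _] := Hrho _ Gij; have [_ _ hk _] := Hrho _ Gkl.
  have [u [up Au fu _]] := hi _ wi; have [u' [up' Au' fu' _]] := hk _ wk.
  have uu : u = u' by apply: finj; rewrite ?inE // fu fu'.
  apply: (cell_center_inj T0 N0); rewrite -uu in up'.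
  have := nm_tri (cell_center T ij) u (cell_center T kl).
  rewrite (nmB _ u); lra.
- by move=> ij w Gij wi; have [_ _ hi _] := Hrho _ Gij; have [u []] := hi _ wi.
Qed.

End Capacity.

(** * Connectedness of round annuli *)

Section Annuli.
Variable R : realType.
Local Notation C := (Cplx R).

Lemma connected_halfplane (l : C -> R) :
  (forall z w t, l (seg_pt z w t) = l z + t * (l w - l z)) ->
  connected [set z : C | 0 < l z].
Proof.
move=> hl; apply: convex_connected => z w t /= lz lw /andP[t0 t1]; rewrite hl; nra.
Qed.

Lemma Re_seg (z w : C) t :
  complex.Re (seg_pt z w t) = complex.Re z + t * (complex.Re w - complex.Re z).
Proof. by case: z w => ? ? [? ?]; rewrite /seg_pt /=; ring. Qed.

Lemma Im_seg (z w : C) t :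
  complex.Im (seg_pt z w t) = complex.Im z + t * (complex.Im w - complex.Im z).
Proof. by case: z w => ? ? [? ?]; rewrite /seg_pt /=; ring. Qed.

(** The punctured plane is a chain of four half planes. *)
Lemma connected_punctured : connected [set z : C | z != 0].
Proof.
have -> : [set z : C | z != 0] =
  ([set z | 0 < complex.Re z] `|` [set z | 0 < complex.Im z]) `|`
  ([set z | 0 < - complex.Re z] `|` [set z | 0 < - complex.Im z]).
  apply/seteqP; split => [[x y]|[x y]] /=.
    rewrite eq_complex /= negb_and !oppr_gt0 => /orP[|].
      by rewrite neq_lt => /orP[|]; [right; left|left; left].
    by rewrite neq_lt => /orP[|]; [right; right|left; right].
  rewrite eq_complex /= negb_and !oppr_gt0.
  by case=> [[|]|[|]] h; apply/orP; [left|right|left|right]; rewrite neq_lt h ?orbT.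
have c1 : connected [set z : C | 0 < complex.Re z].
  by apply: connected_halfplane => z w t; exact: Re_seg.
have c2 : connected [set z : C | 0 < complex.Im z].
  by apply: connected_halfplane => z w t; exact: Im_seg.
have c3 : connected [set z : C | 0 < - complex.Re z].
  apply: (@connected_halfplane (fun z : C => - complex.Re z)) => z w t.
  by rewrite Re_seg; ring.
have c4 : connected [set z : C | 0 < - complex.Im z].
  apply: (@connected_halfplane (fun z : C => - complex.Im z)) => z w t.
  by rewrite Im_seg; ring.
apply: connectedU; last 2 first.
- by apply: connectedU => //; exists (1 +i* 1)%C; split; exact: ltr01.
- by apply: connectedU => //; exists (-1 -i* 1)%C; split; rewrite /= opprK; exact: ltr01.
by exists (1 -i* 1)%C; split; [left|right]; rewrite /= ?opprK; exact: ltr01.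
Qed.

Lemma continuous_RC : continuous (fun x : R => x%:C%C : C).
Proof.
move=> x P /nbhs_nm[e e0 hP]; apply/nbhs_ballP; exists e => // y.
rewrite -ball_normE /= => h; apply: hP.
by rewrite -rmorphB /= nm_real distrC.
Qed.

(** A set of points described by their modulus is the image of the punctured
    plane under a map rescaling each ray. *)
Lemma radial_connected (psi : R -> R) :
  (forall t, 0 < t -> {for t, continuous psi}) -> (forall t, 0 < t -> 0 < psi t) ->
  connected [set z : C | exists2 t, 0 < t & psi t = nm z].
Proof.
move=> cpsi psi0.
pose F (z : C) : C := (psi (nm z) / nm z)%:C%C * z.
have -> : [set z : C | exists2 t, 0 < t & psi t = nm z] = F @` [set z | z != 0].
  apply/seteqP; split => [z [t t0 tz]|_ [z /= z0 <-]].
    have nz : 0 < nm z by rewrite -tz psi0.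
    exists ((t / nm z)%:C%C * z) => /=.
      by rewrite -nm_gt0 nmM nm_real mulr_gt0 // normr_gt0 gt_eqF // divr_gt0.
    have e : nm ((t / nm z)%:C%C * z) = t.
      by rewrite nmM nm_real gtr0_norm ?divr_gt0 // divfK // gt_eqF.
    rewrite /F e tz mulrA -rmorphM /=.
    have -> : nm z / t * (t / nm z) = 1 by field; rewrite !gt_eqF.
    by rewrite rmorph1 mul1r.
  have nz : 0 < nm z by rewrite nm_gt0.
  exists (nm z) => //; rewrite /F nmM nm_real gtr0_norm ?divr_gt0 ?psi0 //.
  by rewrite divfK // gt_eqF.
apply: connected_continuous_connected; first exact: connected_punctured.
apply: continuous_in_subspaceT => z; rewrite inE /= => z0.
have nz : 0 < nm z by rewrite nm_gt0.
have c1 : psi (nm x) @[x --> z] --> psi (nm z).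
  exact: (continuous_comp (@continuous_nm R z) (cpsi _ nz)).
have c2 : psi (nm x) / nm x @[x --> z] --> psi (nm z) / nm z.
  by apply: (cvgM c1); apply: cvgV; [rewrite gt_eqF | exact: continuous_nm].
have c3 : (psi (nm x) / nm x)%:C%C @[x --> z] --> ((psi (nm z) / nm z)%:C%C : C).
  exact: (cvg_comp _ (fun x : R => x%:C%C : C) c2 (@continuous_RC _)).
exact: (cvgM c3 cvg_id).
Qed.

(** [(a + b * t) / (1 + t)] runs over the interval from [a] to [b]. *)
Lemma connected_annulus0 (a b : R) : 0 <= a -> a < b ->
  connected [set z : C | a < nm z < b].
Proof.
move=> a0 ab.
have -> : [set z : C | a < nm z < b] =
    [set z : C | exists2 t, 0 < t & (a + b * t) / (1 + t) = nm z].
  apply/seteqP; split => z /=.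
    move=> /andP[h1 h2]; exists ((nm z - a) / (b - nm z)).
      by rewrite divr_gt0 ?subr_gt0.
    by field; apply/andP; split; rewrite gt_eqF //; lra.
  move=> [t t0 <-]; have t1 : 0 < 1 + t by lra.
  by rewrite ltr_pdivlMr // ltr_pdivrMr //; apply/andP; split; nra.
apply: radial_connected => t t0; have t1 : 0 < 1 + t by lra.
  apply: cvgM.
    by apply: cvgD; [exact: cvg_cst | apply: cvgM; [exact: cvg_cst | exact: cvg_id]].
  apply: cvgV; first by rewrite gt_eqF.
  by apply: cvgD; [exact: cvg_cst | exact: cvg_id].
by rewrite divr_gt0 //; nra.
Qed.

Lemma connected_exterior0 (b : R) : 0 < b -> connected [set z : C | b <= nm z].
Proof.
move=> b0.
have -> : [set z : C | b <= nm z] = [set z : C | exists2 t, 0 < t & Num.max b t = nm z].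
  apply/seteqP; split => z /=.
    by move=> h; exists (nm z); [exact: lt_le_trans h | rewrite max_r].
  by move=> [t t0 <-]; rewrite le_max lexx.
apply: radial_connected => t t0; last by rewrite lt_max b0.
have := @continuous_max R R (fun=> b) id t; apply; [exact: cvg_cst | exact: cvg_id].
Qed.

Lemma translate_connected (S : set C) (w : C) :
  connected S -> connected [set z | S (z - w)].
Proof.
move=> cS; have -> : [set z | S (z - w)] = (fun z => z + w) @` S.
  apply/seteqP; split => [z h|_ [z h <-]] /=; last by rewrite addrK.
  by exists (z - w) => //; rewrite subrK.
apply: connected_continuous_connected => //; apply: continuous_subspaceT => z.
apply/cvg_nmP => e e0; exists e => // x hx.
by have -> : x + w - (z + w) = x - z by ring.
Qed.

Lemma connected_annulus (w : C) (a b : R) : 0 <= a -> a < b ->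
  connected [set z : C | a < nm (z - w) < b].
Proof. by move=> a0 ab; exact/(translate_connected (S := [set z | a < nm z < b]))/connected_annulus0. Qed.

Lemma connected_exterior (w : C) (b : R) : 0 < b ->
  connected [set z : C | b <= nm (z - w)].
Proof. by move=> b0; exact/(translate_connected (S := [set z | b <= nm z]))/connected_exterior0. Qed.

Lemma connected_disc (w : C) (a : R) : connected [set z : C | nm (z - w) <= a].
Proof.
apply: convex_connected => z z' t /= hz hz' /andP[t0 t1].
have -> : seg_pt z z' t - w = (1 - t)%:C%C * (z - w) + t%:C%C * (z' - w).
  by rewrite /seg_pt rmorphB rmorph1; ring.
apply: le_trans (nmD _ _) _; rewrite !nmM !nm_real !ger0_norm ?subr_ge0 //.
have : (1 - t) * nm (z - w) <= (1 - t) * a by rewrite ler_wpM2l // subr_ge0.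
have : t * nm (z' - w) <= t * a by rewrite ler_wpM2l.
lra.
Qed.

End Annuli.

(** * Inverse maps, separation and clamped logarithms *)

Section Ends.
Variable R : realType.
Local Notation C := (Cplx R).
Implicit Types (r s : R).

Definition locally_linear (A : set C) (f : C -> C) := forall z, A z ->
  exists2 rho, 0 < rho & (forall w, nm (w - z) <= rho -> A w) /\
    exists L, nearly_linear f z rho L.

Lemma locally_linear_continuous A f z : locally_linear A f -> A z ->
  {for z, continuous f}.
Proof.
move=> loc /loc[rho rho0 [_ [L nl]]]; apply/cvg_nmP => e e0.
have L0 : 0 < nm L by rewrite nm_gt0; case: nl.
have c0 : 0 < 5 / 4 * nm L by rewrite mulr_gt0.
exists (Num.min rho (e / (5 / 4 * nm L))); first by rewrite lt_min rho0 divr_gt0.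
move=> w; rewrite lt_min => /andP[h1 h2].
apply: le_lt_trans (nearly_linear_lipschitz nl (ltW h1) _) _.
  by rewrite subrr nm0 ltW.
by rewrite mulrC -ltr_pdivlMr.
Qed.

(** A point [w] close to [f z] has a preimage close to [z] by
    [nearly_linear_surjective], and by injectivity it is [g w]. *)
Lemma inverse_continuous A f g z : locally_linear A f -> set_inj A f ->
  (forall w, (f @` A) w -> A (g w) /\ f (g w) = w) -> A z ->
  {for f z, continuous g}.
Proof.
move=> loc inj hg Az; have [rho rho0 [hA [L nl]]] := loc z Az.
have L0 : 0 < nm L by rewrite nm_gt0; case: nl.
apply/cvg_nmP => e e0; pose d := Num.min rho (e / 2).
have d0 : 0 < d by rewrite lt_min rho0 divr_gt0.
have gfz : g (f z) = z.
  have [|a b] := hg (f z); first by exists z.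
  by apply: inj; rewrite ?inE.
exists (nm L * d / 4); first by rewrite divr_gt0 // mulr_gt0.
move=> w hw; have d1 : d <= rho by rewrite /d ge_min lexx.
have d2 : d <= e / 2 by rewrite /d ge_min lexx orbT.
have nl' : nearly_linear f z d L.
  by apply: nearly_linear_sub nl _; rewrite subrr nm0 add0r.
have [u hu fu] := nearly_linear_surjective d0 nl' (ltW hw).
have Au : A u by apply: hA; exact: le_trans d1.
have [|a b] := hg w; first by exists u.
have -> : g w = u by apply: inj; rewrite ?inE // b fu.
by rewrite gfz; lra.
Qed.

Lemma disjoint_neighbourhoods (K0 K1 : set C) :
  compact K0 -> closed K1 -> (forall z, K0 z -> K1 z -> False) ->
  exists N0 N1 : set C, [/\ open N0, open N1, K0 `<=` N0, K1 `<=` N1 &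
    forall z, N0 z -> N1 z -> False].
Proof.
move=> cK0 clK1 dis.
have [d d0 hd] : exists2 d, 0 < d & forall k k', K0 k -> K1 k' -> d <= nm (k' - k).
  have /compact_near_coveringP cov := cK0.
  have H : \forall d \near (0 : R)^'+, K0 `<=` fun k => forall k', K1 k' -> d <= nm (k' - k).
    apply: (cov R (0 : R)^'+ (fun d k => forall k', K1 k' -> d <= nm (k' - k))) => x Kx.
    have /open_nm/(_ x)[|e e0 he] := closed_openC clK1; first by move=> /(dis _ Kx).
    exists ([set k | nm (k - x) < e / 2], [set d | d <= e / 2]).
      have e2 : 0 < e / 2 by lra.
      by split => /=; [apply/nbhs_nm; exists (e / 2) | exact: nbhs_right_le].
    move=> [k d] /= [hk hd] k' Kk'; apply: le_trans hd _; rewrite leNgt; apply/negP => h.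
    by apply: (he k' _ Kk'); have := nm_tri k' k x; lra.
  have [d [d0 hd]] := @filter_ex _ (at_right (0 : R)) _ _ (filterI (nbhs_right_gt (0 : R)) H).
  by exists d => // k k' Kk; exact: hd.
have oN (K : set C) : open [set z | exists2 k, K k & nm (z - k) < d / 2].
  apply/open_nm => z [k Kk hk]; exists (d / 2 - nm (z - k)); first by lra.
  by move=> w hw; exists k => //; have := nm_tri w z k; lra.
exists [set z | exists2 k, K0 k & nm (z - k) < d / 2],
       [set z | exists2 k, K1 k & nm (z - k) < d / 2]; split; rewrite //.
- by move=> k Kk; exists k => //; rewrite subrr nm0; lra.
- by move=> k Kk; exists k => //; rewrite subrr nm0; lra.
move=> z [k Kk hk] [k' Kk' hk']; have := hd _ _ Kk Kk'.
by have := nm_tri k' z k; rewrite (nmB k' z); lra.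
Qed.

Lemma connected_plane : connected [set: C].
Proof. by apply: convex_connected. Qed.

Definition clamp (r1 r2 x : R) := Num.max r1 (Num.min x r2).

(** The concavity bound [ln b - ln a <= (b - a) / a] settles the case where
    clamping leaves the smaller number above [m]; otherwise [r2 < m], and both
    numbers are clamped to [r2]. *)
Lemma ln_clamp_lipschitz (r1 r2 m x y : R) : 0 < r1 -> r1 <= r2 -> 0 < m ->
  m <= x -> m <= y -> `|ln (clamp r1 r2 x) - ln (clamp r1 r2 y)| <= `|x - y| / m.
Proof.
move=> r0 r12 m0.
suff H (a b : R) : m <= a -> a <= b ->
    `|ln (clamp r1 r2 a) - ln (clamp r1 r2 b)| <= `|a - b| / m.
  move=> hx hy; have [xy|/ltW xy] := leP x y; first exact: H.
  by rewrite distrC (distrC x); exact: H.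
move=> ha ab.
have c0 t : 0 < clamp r1 r2 t by rewrite lt_max r0.
have rc t : r1 <= clamp r1 r2 t by rewrite le_max lexx.
have mc t : Num.min t r2 <= clamp r1 r2 t by rewrite le_max lexx orbT.
have cab : clamp r1 r2 a <= clamp r1 r2 b.
  rewrite {1}/clamp ge_max rc /=; apply: le_trans (mc b).
  by rewrite le_min !ge_min ab lexx orbT.
have lab : clamp r1 r2 b - clamp r1 r2 a <= b - a.
  rewrite lerBlDr {1}/clamp ge_max; apply/andP; split; first by have := rc a; lra.
  rewrite ge_min; apply/orP; have := mc a.
  by have [h|/ltW h] := leP a r2; [left|right]; lra.
rewrite !ler0_norm ?subr_le0 ?ler_ln ?posrE // !opprB.
rewrite -ln_div ?posrE //.
have [ca|ca] := leP m (clamp r1 r2 a).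
  have -> : clamp r1 r2 b / clamp r1 r2 a =
      1 + (clamp r1 r2 b - clamp r1 r2 a) / clamp r1 r2 a by field; rewrite gt_eqF.
  apply: le_trans (le_ln1Dx _) _.
    have : 0 <= (clamp r1 r2 b - clamp r1 r2 a) / clamp r1 r2 a.
      by rewrite divr_ge0 ?subr_ge0 // ltW.
    lra.
  apply: ler_pM => //; rewrite ?subr_ge0 ?invr_ge0 ?(ltW (c0 _)) //.
  by rewrite lef_pV2 ?posrE.
have r2a : r2 < a.
  by rewrite ltNge; apply/negP => h; have := mc a; rewrite min_l //; lra.
have e t : a <= t -> clamp r1 r2 t = r2.
  by move=> h; rewrite /clamp min_r ?max_r //; lra.
by rewrite !e // divff ?ln1 ?divr_ge0 ?subr_ge0 // ?(ltW m0) // gt_eqF //; lra.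
Qed.

End Ends.

(** * A potential on a conformal annulus *)

Section Potential.
Variable R : realType.
Local Notation C := (Cplx R).
Implicit Types (r s : R).

(** The sets [V] and [W] stand for the parts of [A] near the two boundary circles
    of the image. If both of them lay near [K0], then nothing but [K1] would be
    left near [K1], and [K1] would be open and closed. *)
Lemma both_ends_absurd (A K0 K1 N0 N1 K V W : set C) :
  ~` A = K0 `|` K1 -> closed K1 -> K0 !=set0 -> K1 !=set0 ->
  K0 `<=` N0 -> K1 `<=` N1 -> open N1 -> (forall z, N0 z -> N1 z -> False) ->
  closed K -> K `<=` A -> A `<=` K `|` (V `|` W) ->
  V `<=` N0 -> W `<=` N0 -> False.
Proof.
move=> eA clK1 [k0 K0k] [k1 K1k] KN0 KN1 oN1 dis clK KA Adec VN WN.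
have notA z : K1 z -> ~ A z.
  by move=> Kz; have : (~` A) z by [rewrite eA; right].
have eK1 : K1 = N1 `&` ~` K.
  apply/seteqP; split => [z Kz|z [Nz nK]].
    by split; [exact: KN1 | move=> /KA; exact: notA].
  have [Az|nA] := pselect (A z).
    by have [//|[/VN|/WN] /dis] := Adec z Az.
  have : (~` A) z by [].
  by rewrite eA => -[/KN0/dis|].
have oK1 : open K1 by rewrite eK1; apply: openI => //; exact: closed_openC.
have [||||h|h] := @connected_open_split _ [set: C] K1 (~` K1) _ oK1.
- exact: connected_plane.
- exact: closed_openC.
- by move=> z _; exact: EM.
- by move=> z _.
- by apply: (dis k0); [exact: KN0 | exact/KN1/h].
- exact: (h k1).
Qed.

(** The ends of [A] correspond to the two boundary circles. The part of [A]
    outside disjoint neighbourhoods [N0], [N1] of [K0], [K1] is compact, so [f]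
    maps it into some [p1 < |w| < p2]. The preimages [V] of [|w| < p1] and [W] of
    [|w| > p2] are connected, hence each lies in [N0] or in [N1], and not both in
    the same one by [both_ends_absurd]. The logarithm of [|f|] clamped between
    [p1] and [p2] is constant on [V] and on [W], and extends by these constants
    to [K0] and [K1]. Which constant goes with which component depends on the
    orientation of [f]. *)
Lemma annulus_potential (A K0 K1 : set C) f (r1 r2 s1 s2 B : R) :
  open A -> ~` A = K0 `|` K1 -> compact K0 -> closed K1 -> K0 !=set0 -> K1 !=set0 ->
  (forall z, K0 z -> K1 z -> False) -> (forall z, A z -> nm z <= B) ->
  0 < r1 -> r1 < s1 -> s1 <= s2 -> s2 < r2 ->
  (forall z, A z -> r1 < nm (f z) < r2) -> set_inj A f ->
  (forall w, r1 < nm w < r2 -> (f @` A) w) -> locally_linear A f ->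
  exists (K : set C) (v : C -> R) (e0 e1 : R),
  [/\ compact K /\ K `<=` A,
     forall z w m, A z -> A w -> 0 < m -> m <= nm (f z) -> m <= nm (f w) ->
       `|v z - v w| <= nm (f z - f w) / m,
     forall z, ~ K z -> \forall w \near z, v w = v z,
     (forall z, K0 z -> v z = e0) /\ (forall z, K1 z -> v z = e1) &
     ln (s2 / s1) <= `|e0 - e1|].
Proof.
move=> oA eA cK0 clK1 K00 K10 dis bA r0 rs1 s12 sr2 fr inj surj loc.
have [N0 [N1 [oN0 oN1 KN0 KN1 disN]]] := disjoint_neighbourhoods cK0 clK1 dis.
have clK0 : closed K0 := compact_closed (@hausdorff_C R) cK0.
have fcont z : A z -> {for z, continuous f} by exact: locally_linear_continuous.
pose D := ~` (N0 `|` N1).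
have DA : D `<=` A.
  move=> z nN; apply: contrapT => nA; have : (~` A) z by [].
  by rewrite eA => -[/KN0|/KN1] h; apply: nN; [left|right].
have cD : compact D.
  apply: (@bounded_compact R _ B); first by apply: open_closedC; exact: openU.
  by move=> z /DA/bA.
have nfcont : {within D, continuous (fun z => nm (f z))}.
  apply: continuous_in_subspaceT => z; rewrite inE => /DA Az.
  by apply: (continuous_comp (fcont z Az)); exact: continuous_nm.
have [p1 [p1r p1s Dp1]] : exists p1, [/\ r1 < p1, p1 <= s1 & forall z, D z -> p1 < nm (f z)].
  have [D0|/set0P/negP/negPn/eqP D0] := pselect (D !=set0); last first.
    by exists s1; split => // z; rewrite D0.
  have [c] := compact_EVT_min D0 cD nfcont; rewrite inE => Dc hc.
  have /andP[c1 c2] := fr c (DA _ Dc).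
  exists (Num.min s1 ((r1 + nm (f c)) / 2)); split.
  - by rewrite lt_min rs1; lra.
  - by rewrite ge_min lexx.
  - move=> z Dz; have := hc z; rewrite inE => /(_ Dz); rewrite gt_min.
    by move=> h; apply/orP; right; lra.
have [p2 [p2r p2s Dp2]] : exists p2, [/\ p2 < r2, s2 <= p2 & forall z, D z -> nm (f z) < p2].
  have [D0|/set0P/negP/negPn/eqP D0] := pselect (D !=set0); last first.
    by exists s2; split => // z; rewrite D0.
  have [c] := compact_EVT_max D0 cD nfcont; rewrite inE => Dc hc.
  have /andP[c1 c2] := fr c (DA _ Dc).
  exists (Num.max s2 ((r2 + nm (f c)) / 2)); split.
  - by rewrite gt_max sr2; lra.
  - by rewrite le_max lexx.
  - move=> z Dz; have := hc z; rewrite inE => /(_ Dz); rewrite lt_max.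
    by move=> h; apply/orP; right; lra.
have : forall w, exists z, (f @` A) w -> A z /\ f z = w.
  move=> w; have [[z Az fz]|n] := pselect ((f @` A) w); first by exists z.
  by exists 0.
move=> /choice[g hg].
have gcont w : r1 < nm w < r2 -> {for w, continuous g}.
  move=> /surj[z Az <-]; exact: (inverse_continuous loc inj hg Az).
have gimage (S : set C) : S `<=` [set w | r1 < nm w < r2] ->
    g @` S = [set z | A z /\ S (f z)].
  move=> hS; apply/seteqP; split => [_ [w Sw <-]|z [Az Sz]] /=.
    by have [a b] := hg w (surj _ (hS _ Sw)); rewrite b.
  exists (f z) => //; have [|a b] := hg (f z); first by exists z.
  by apply: inj; rewrite ?inE.
have gwithin (S : set C) : S `<=` [set w | r1 < nm w < r2] -> {within S, continuous g}.
  by move=> hS; apply: continuous_in_subspaceT => w; rewrite inE => /hS; exact: gcont.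
pose K := [set z | A z /\ p1 <= nm (f z) <= p2].
pose V := [set z | A z /\ r1 < nm (f z) < p1].
pose W := [set z | A z /\ p2 < nm (f z) < r2].
have p12 : p1 <= p2 by lra.
have cK : compact K.
  pose S : set C := [set w | p1 <= nm w <= p2].
  have hS : S `<=` [set w | r1 < nm w < r2].
    by move=> w /andP[a b] /=; apply/andP; split; lra.
  have -> : K = g @` S by rewrite gimage.
  apply: continuous_compact; first exact: gwithin.
  have -> : S = [set w | nm (w - 0) <= p2] `&` ~` [set w | nm w < p1].
    apply/seteqP; split => w /=; rewrite subr0.
      by move=> /andP[a b]; split => //; apply/negP; rewrite -leNgt.
    by move=> [b /negP]; rewrite -leNgt => a; apply/andP.
  apply: compact_closedI; first exact: compact_disc.
  apply: open_closedC; apply/open_nm => w hw /=; exists (p1 - nm w); first by rewrite subr_gt0.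
  by move=> w' h; have := nm_sub w' w; lra.
have clK : closed K := compact_closed (@hausdorff_C R) cK.
have cV : connected V.
  have -> : V = g @` [set w | r1 < nm w < p1].
    by rewrite gimage // => w /andP[a b] /=; apply/andP; split; lra.
  apply: connected_continuous_connected; first by apply: connected_annulus0 => //; exact: ltW.
  by apply: gwithin => w /andP[a b] /=; apply/andP; split; lra.
have cW : connected W.
  have -> : W = g @` [set w | p2 < nm w < r2].
    by rewrite gimage // => w /andP[a b] /=; apply/andP; split; lra.
  apply: connected_continuous_connected; first by apply: connected_annulus0 => //; lra.
  by apply: gwithin => w /andP[a b] /=; apply/andP; split; lra.
have Adec : A `<=` K `|` (V `|` W).
  move=> z Az; have /andP[a b] := fr z Az.
  have [h1|h1] := ltP (nm (f z)) p1; first by right; left; split => //; rewrite a h1.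
  have [h2|h2] := ltP p2 (nm (f z)); first by right; right; split => //; rewrite b h2.
  by left; split => //; rewrite h1 h2.
have VNN : V `<=` N0 `|` N1.
  move=> z [Az /andP[_ h]]; apply: contrapT => nN; have := Dp1 z nN; lra.
have WNN : W `<=` N0 `|` N1.
  move=> z [Az /andP[h _]]; apply: contrapT => nN; have := Dp2 z nN; lra.
have KA : K `<=` A by move=> z [].
pose v e0 e1 z := if `[< A z >] then ln (clamp p1 p2 (nm (f z)))
                  else if `[< K0 z >] then e0 else e1 : R.
have p10 : 0 < p1 by lra.
have vA e0 e1 z : A z -> v e0 e1 z = ln (clamp p1 p2 (nm (f z))).
  by move=> Az; rewrite /v asboolT.
have vV e0 e1 z : V z -> v e0 e1 z = ln p1.
  by move=> [Az /andP[_ h]]; rewrite vA // /clamp min_l ?max_l //; lra.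
have vW e0 e1 z : W z -> v e0 e1 z = ln p2.
  by move=> [Az /andP[h _]]; rewrite vA // /clamp min_r ?max_r //; lra.
have K0A z : K0 z -> ~ A z.
  by move=> Kz; have : (~` A) z by [rewrite eA; left].
have K1A z : K1 z -> ~ A z.
  by move=> Kz; have : (~` A) z by [rewrite eA; right].
have v0 e0 e1 z : K0 z -> v e0 e1 z = e0.
  by move=> Kz; rewrite /v asboolF ?asboolT //; exact: K0A.
have v1 e0 e1 z : K1 z -> v e0 e1 z = e1.
  move=> Kz; rewrite /v asboolF ?asboolF //; last exact: K1A.
  by move=> /dis; apply.
have vlip e0 e1 z w m : A z -> A w -> 0 < m -> m <= nm (f z) -> m <= nm (f w) ->
     `|v e0 e1 z - v e0 e1 w| <= nm (f z - f w) / m.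
  move=> Az Aw m0 hz hw; rewrite !vA //.
  apply: le_trans (ln_clamp_lipschitz p10 p12 m0 hz hw) _.
  rewrite ler_wpM2r ?invr_ge0 ?(ltW m0) // ler_norml.
  have := nm_sub (f z) (f w); have := nm_sub (f w) (f z); rewrite (nmB (f w)).
  by move=> a b; apply/andP; split; lra.
have lnp : ln (s2 / s1) <= `|ln p1 - ln p2|.
  rewrite distrC ger0_norm; last by rewrite subr_ge0 ler_ln ?posrE //; lra.
  rewrite -ln_div ?posrE ?ler_ln ?posrE ?divr_gt0 ?ler_pdivrMr //; try lra.
  rewrite mulrAC ler_pdivlMr //; nra.
have vloc e0 e1 : (forall z, N0 z -> ~ K z -> v e0 e1 z = e0) ->
    (forall z, N1 z -> ~ K z -> v e0 e1 z = e1) ->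
    forall z, ~ K z -> \forall w \near z, v e0 e1 w = v e0 e1 z.
  move=> h0 h1 z nK; have oK : open (~` K) by exact: closed_openC.
  have nbK : nbhs z (~` K) by exact: open_nbhs_nbhs.
  have [Nz|Nz] : N0 z \/ N1 z.
    have [/Adec[//|[/VNN|/WNN]]//|nA] := pselect (A z).
    have : (~` A) z by [].
    by rewrite eA => -[/KN0|/KN1]; [left|right].
  - near=> w; rewrite !h0 //; first by near: w; exact: open_nbhs_nbhs.
    by near: w.
  - near=> w; rewrite !h1 //; first by near: w; exact: open_nbhs_nbhs.
    by near: w.
have split_ends : (V `<=` N0 /\ W `<=` N1) \/ (V `<=` N1 /\ W `<=` N0).
  have [|V0|V1] := connected_open_split cV oN0 oN1 VNN; first by move=> z _; exact: disN.
  - have [|W0|W1] := connected_open_split cW oN0 oN1 WNN; first by move=> z _; exact: disN.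
      by have := both_ends_absurd eA clK1 K00 K10 KN0 KN1 oN1 disN clK KA Adec V0 W0.
    by left.
  - have [|W0|W1] := connected_open_split cW oN0 oN1 WNN; first by move=> z _; exact: disN.
      by right.
    rewrite setUC in eA.
    have disN' z : N1 z -> N0 z -> False by move=> a b; exact: disN b a.
    by have := both_ends_absurd eA clK0 K10 K00 KN1 KN0 oN0 disN' clK KA Adec V1 W1.
have outA z : ~ A z -> K0 z \/ K1 z by move=> nA; have : (~` A) z by []; rewrite eA.
case: split_ends => -[VN WN].
- exists K, (v (ln p1) (ln p2)), (ln p1), (ln p2); split => //; first exact: vlip.
    apply: vloc => z Nz nK; have [Az|/outA[Kz|Kz]] := pselect (A z).
    + by have [//|[/vV//|/WN Nz']] := Adec z Az; case: (disN z).
    + exact: v0.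
    + by case: (disN z Nz (KN1 _ Kz)).
    + by have [//|[/VN Nz'|/vW//]] := Adec z Az; case: (disN z).
    + by case: (disN z (KN0 _ Kz) Nz).
    + exact: v1.
  by split; [exact: v0 | exact: v1].
- exists K, (v (ln p2) (ln p1)), (ln p2), (ln p1); split => //; first exact: vlip.
  + apply: vloc => z Nz nK; have [Az|/outA[Kz|Kz]] := pselect (A z).
    + by have [//|[/VN Nz'|/vW//]] := Adec z Az; case: (disN z).
    + exact: v0.
    + by case: (disN z Nz (KN1 _ Kz)).
    + by have [//|[/vV//|/WN Nz']] := Adec z Az; case: (disN z).
    + by case: (disN z (KN0 _ Kz) Nz).
    + exact: v1.
  + by split; [exact: v0 | exact: v1].
  + by rewrite distrC.
Unshelve. all: by end_near. Qed.

End Potential.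

(** * Choosing the squares *)

Section Teichmuller.
Variable R : realType.
Local Notation C := (Cplx R).

Lemma continuous_sup_norm : continuous (@sup_norm R).
Proof.
move=> z; apply: (@continuous_max R C (fun z => `|complex.Re z|) (fun z => `|complex.Im z|)).
  by apply: (continuous_comp (@continuous_Re R z)); exact: norm_continuous.
by apply: (continuous_comp (@continuous_Im R z)); exact: norm_continuous.
Qed.

Lemma nm_le_sup_norm (z : C) : nm z <= 2 * sup_norm z.
Proof.
apply: le_trans (nm_ReIm _) _; have : `|complex.Re z| <= sup_norm z by rewrite le_max lexx.
by have : `|complex.Im z| <= sup_norm z by [rewrite le_max lexx orbT]; lra.
Qed.

(** The similarity taking [S] to [base] and [S + 1] to [base + alpha]. *)
Definition affine_map (base alpha : C) (S : R) (x : C) : C := base + alpha * (x - S%:C%C).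

Section Affine.
Variables (base alpha : C) (S : R).
Hypothesis alpha0 : alpha != 0.
Let sigma := affine_map base alpha S.
Let tau (w : C) : C := (w - base) / alpha + S%:C%C.

Lemma affine_mapK : cancel sigma tau.
Proof. by move=> x; rewrite /tau /sigma /affine_map; field. Qed.

Lemma affine_mapVK : cancel tau sigma.
Proof. by move=> x; rewrite /tau /sigma /affine_map; field. Qed.

Lemma affine_map_sub x y : sigma x - sigma y = alpha * (x - y).
Proof. by rewrite /sigma /affine_map; ring. Qed.

Lemma affine_inv_sub x y : tau x - tau y = (x - y) / alpha.
Proof. by rewrite /tau; field. Qed.

Lemma continuous_affine_inv : continuous tau.
Proof.
move=> z; apply/cvg_nmP => e e0; exists (e * nm alpha); first by rewrite mulr_gt0 ?nm_gt0.
by move=> w; rewrite affine_inv_sub nmM nmV ltr_pdivrMr ?nm_gt0.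
Qed.

Lemma continuous_affine : continuous sigma.
Proof.
move=> z; apply/cvg_nmP => e e0; exists (e / nm alpha); first by rewrite divr_gt0 ?nm_gt0.
by move=> w hw; rewrite affine_map_sub nmM mulrC -ltr_pdivlMr ?nm_gt0.
Qed.

Lemma affine_locally_linear (A : set C) f : locally_linear A f ->
  locally_linear [set x | A (sigma x)] (f \o sigma).
Proof.
have na : 0 < nm alpha by rewrite nm_gt0.
move=> loc x /loc[rho rho0 [hA [L [L0 nl]]]].
have sub u : nm (u - x) <= rho / nm alpha -> nm (sigma u - sigma x) <= rho.
  by move=> h; rewrite affine_map_sub nmM mulrC -ler_pdivlMr.
exists (rho / nm alpha); first by rewrite divr_gt0.
split; first by move=> w hw; apply: hA; exact: sub.
exists (alpha * L); split; first by rewrite mulf_neq0.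
move=> u w hu hw; have := nl _ _ (sub _ hu) (sub _ hw).
rewrite /= affine_map_sub !nmM.
have -> : L * (alpha * (u - w)) = alpha * L * (u - w) by ring.
by have -> : nm L / 4 * (nm alpha * nm (u - w)) = nm alpha * nm L / 4 * nm (u - w) by ring.
Qed.

(** The capacity bound seen through a similarity: squares become squares
    rotated and centred at will. *)
Lemma capacity_bound_affine (A K K0 K1 : set C) (f : C -> C) (v : C -> R)
    (r T e0 e1 : R) (P q : nat) :
  compact K -> K `<=` A -> 0 < r ->
  (forall z, A z -> r <= nm (f z) < 2 ^+ P * r) -> set_inj A f ->
  locally_linear A f ->
  (forall z w m, A z -> A w -> 0 < m -> m <= nm (f z) -> m <= nm (f w) ->
     `|v z - v w| <= nm (f z - f w) / m) ->
  (forall z, ~ K z -> \forall w \near z, v w = v z) ->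
  connected K0 -> connected K1 ->
  (forall z, K0 z -> v z = e0) -> (forall z, K1 z -> v z = e1) ->
  0 < T -> (0 < q)%N ->
  (exists2 k, K0 k & sup_norm (tau k) <= T - 2 * T / q%:R) ->
  (exists2 k, K0 k & T <= sup_norm (tau k)) ->
  (exists2 k, K1 k & sup_norm (tau k) <= T - 2 * T / q%:R) ->
  (exists2 k, K1 k & T <= sup_norm (tau k)) ->
  `|e0 - e1| ^+ 2 <= 64 * q%:R * (160 ^+ 2 * (16 * P%:R)).
Proof.
move=> cK KA r0 fr inj loc vlip vloc cK0 cK1 v0 v1 T0 q0 a0 b0 a1 b1.
have cross (S' : set C) t : connected S' ->
    (exists2 k, S' k & sup_norm (tau k) <= T - 2 * T / q%:R) ->
    (exists2 k, S' k & T <= sup_norm (tau k)) ->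
    T - 2 * T / q%:R <= t <= T -> exists2 x, S' (sigma x) & sup_norm x = t.
  move=> cS [k Sk hk] [k' Sk' hk'] /andP[t1 t2].
  have : connected ((fun w => sup_norm (tau w)) @` S').
    apply: connected_continuous_connected => //; apply: continuous_subspaceT => z.
    by apply: (continuous_comp (@continuous_affine_inv z)); exact: continuous_sup_norm.
  move/connected_intervalP => /(_ (sup_norm (tau k)) (sup_norm (tau k'))) H.
  have [|||w Sw <-] := H _ _ t; [by exists k|by exists k'|by apply/andP; split; lra|].
  by exists (tau w) => //; rewrite affine_mapVK.
have fr' x : A (sigma x) -> r <= nm (f (sigma x)) < 2 ^+ P * r by exact: fr.
apply: (@capacity_bound R [set x | A (sigma x)] [set x | K (sigma x)] (f \o sigma) (v \o sigma) r T _ P q).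
- have -> : [set x | K (sigma x)] = tau @` K.
    apply/seteqP; split => [x Kx|_ [w Kw <-]] /=; last by rewrite affine_mapVK.
    by exists (sigma x) => //; rewrite affine_mapK.
  by apply: continuous_compact => //; apply: continuous_subspaceT; exact: continuous_affine_inv.
- by move=> x /KA.
- by [].
- by move=> x; exact: fr.
- move=> x y; rewrite !inE => Ax Ay /= e.
  by apply: (can_inj affine_mapK); apply: inj; rewrite ?inE.
- exact: affine_locally_linear.
- by move=> z w m Az Aw; exact: vlip.
- move=> z nK; have := vloc _ nK; exact: (@continuous_affine z).
- by [].
- by [].
- by [].
- move=> t tT; have [x0 Kx0 s0] := cross K0 t cK0 a0 b0 tT.
  have [x1 Kx1 s1] := cross K1 t cK1 a1 b1 tT.
  by exists x0, x1; split => //=; rewrite (v0 _ Kx0) (v1 _ Kx1).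
Qed.

End Affine.

(** A complementary component containing two points at distance [nm alpha] and
    another one, unbounded, with a point at distance at most [Q * nm alpha]
    force the modulus to be bounded. After a similarity the two points are [0]
    and [1]; of the two possible orders, one puts the third point closer to
    [0] in real part. Seen from the far left centre [- S], with [S = Q + 2],
    the points [0] and [1] have sup norms [S] and [S + 1] and the third point has
    sup norm at most [S + 1 / 2], so both components cross all the squares of
    half side between [S + 1 / 2] and [T = S + 1]. *)
Lemma squeezed_annulus_bound (A K K0 K1 : set C) (f : C -> C) (v : C -> R)
    (r e0 e1 : R) (P Q : nat) (a y b : C) :
  compact K -> K `<=` A -> 0 < r ->
  (forall z, A z -> r <= nm (f z) < 2 ^+ P * r) -> set_inj A f ->
  locally_linear A f ->
  (forall z w m, A z -> A w -> 0 < m -> m <= nm (f z) -> m <= nm (f w) ->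
     `|v z - v w| <= nm (f z - f w) / m) ->
  (forall z, ~ K z -> \forall w \near z, v w = v z) ->
  connected K0 -> connected K1 ->
  (forall z, K0 z -> v z = e0) -> (forall z, K1 z -> v z = e1) ->
  K0 a -> K0 y -> a != y -> K1 b -> nm (b - y) <= Q%:R * nm (a - y) ->
  (forall M, exists2 k, K1 k & M <= nm k) ->
  `|e0 - e1| ^+ 2 <= 64 * (4 * (Q + 3))%:R * (160 ^+ 2 * (16 * P%:R)).
Proof.
move=> cK KA r0 fr inj loc vlip vloc cK0 cK1 v0 v1 Ka Ky ay Kb hb unb.
have [base [alpha [al0 [Kbase Knext] [hre hnb]]]] : exists base alpha : C,
  [/\ alpha != 0, K0 base /\ K0 (base + alpha) &
    complex.Re ((b - base) / alpha) <= 1 / 2 /\ nm ((b - base) / alpha) <= Q%:R + 1].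
  have al0 : a - y != 0 by rewrite subr_eq0.
  have nal : 0 < nm (a - y) by rewrite nm_gt0.
  have nb : nm ((b - y) / (a - y)) <= Q%:R by rewrite nmM nmV ler_pdivrMr.
  have [h|h] := leP (complex.Re ((b - y) / (a - y))) (1 / 2).
    exists y, (a - y); split => //; first by split => //; rewrite addrC subrK.
    by split => //; lra.
  exists a, (y - a).
  have al0' : y - a != 0 by rewrite subr_eq0 eq_sym.
  have e : (b - a) / (y - a) = 1 - (b - y) / (a - y) by field; rewrite al0 al0'.
  split => //; first by split => //; rewrite addrC subrK.
  rewrite e; split; first by rewrite raddfB /=; lra.
  by apply: le_trans (nmBD _ _) _; rewrite nm1; lra.
have na : 0 < nm alpha by rewrite nm_gt0.
have Q0 : 0 <= Q%:R :> R by [].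
pose S : R := Q%:R + 2; pose T : R := Q%:R + 3.
have eT : T - 2 * T / (4 * (Q + 3))%:R = Q%:R + 5 / 2.
  by rewrite /T natrM natrD; field; rewrite -natrD pnatr_eq0 addnS.
have tauE w : sup_norm ((w - base) / alpha + S%:C%C) =
   Num.max `|complex.Re ((w - base) / alpha) + S| `|complex.Im ((w - base) / alpha)|.
  by move: ((w - base) / alpha) => [c d]; rewrite /sup_norm /= addr0.
apply: (@capacity_bound_affine base alpha S al0 A K K0 K1 f v r T e0 e1 P) => //.
- by rewrite /T; lra.
- by rewrite muln_gt0 addnS.
- exists base => //; rewrite tauE subrr mul0r /= add0r normr0 eT max_l //.
  by rewrite ger0_norm /S; lra.
- exists (base + alpha) => //; rewrite tauE addrAC subrr add0r divff //= normr0.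
  by rewrite le_max ger0_norm /S /T; first (apply/orP; left); lra.
- exists b => //; rewrite tauE eT ge_max.
  have h1 := nm_Re ((b - base) / alpha); have h2 := nm_Im ((b - base) / alpha).
  have h3 := le_trans h1 hnb; rewrite ler_norml in h3; case/andP: h3 => h3 h4.
  apply/andP; split; last by lra.
  by rewrite ger0_norm /S; lra.
- have [k Kk hk] := unb ((2 * T + S) * nm alpha + nm base).
  exists k => //; set w := _ + _.
  have h1 := nm_le_sup_norm w.
  have h2 : (2 * T + S) <= nm ((k - base) / alpha).
    rewrite nmM nmV ler_pdivlMr //; have := nm_sub k base; lra.
  have h3 : nm ((k - base) / alpha) - S <= nm w.
    have := nm_sub ((k - base) / alpha) (- S%:C%C).
    by rewrite nmN nm_real ger0_norm ?opprK // /S; lra.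
  by lra.
Qed.

End Teichmuller.

(** * Thick annuli contain round annuli *)

Section ThickAnnuli.
Variable R : realType.
Local Notation C := (Cplx R).

Lemma bounded_set_nm (S : set C) : bounded_set S -> exists B, forall z, S z -> nm z <= B.
Proof.
move=> [M [Mr hM]]; exists (complex.Re (M + 1)) => z Sz.
have M1 : M < M + 1 by rewrite ltrDl.
by have /= := hM _ M1 z Sz; rewrite nmE lecE => /andP[_].
Qed.

Lemma nm_bounded_set (S : set C) B : (forall z, S z -> nm z <= B) -> bounded_set S.
Proof.
move=> h; exists B%:C%C; split; first by rewrite complex_real.
move=> x hx z Sz /=; rewrite nmE; apply: le_trans (ltW hx); rewrite lecR; exact: h.
Qed.

Lemma component_props (S : set C) (K : set C) : closed S -> components S K ->
  [/\ closed K, connected K, K !=set0 & K `<=` S].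
Proof.
move=> clS [x Sx <-]; split; [exact: component_closed | exact: component_connected | |
  exact: connected_component_sub].
by exists x; exact: connected_component_refl.
Qed.

Lemma components_disjoint (S K L : set C) z : components S K -> components S L ->
  K z -> L z -> K = L.
Proof.
move=> [x Sx <-] [y Sy <-] Kz Lz.
by rewrite (same_connected_component Kz) (same_connected_component Lz).
Qed.

Lemma components_cover (S K L : set C) : components S = [set K; L] -> S = K `|` L.
Proof.
move=> e; rewrite -[LHS](connected_component_cover S) -/(components S) e.
by rewrite bigcup_setU !bigcup_set1.
Qed.

Lemma ln2_ge_half : 1 / 2 <= ln 2 :> R.
Proof.
have h : -1 < - (1 / 2) :> R by lra.
have := le_ln1Dx h; have -> : 1 + - (1 / 2) = 2^-1 :> R by field.
by rewrite lnV ?posrE //; lra.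
Qed.

(** With [r2 = k ^+ 4 * r1], where [k] is the exponential of a quarter of the
    modulus, the middle half of the annulus lies between [k * r1] and
    [k ^+ 3 * r1], and [2 * m + 1] dyadic shells suffice to cover it all. *)
Lemma modulus_radii (r1 r2 m : R) : 0 < r1 -> r1 < r2 -> m = ln (r2 / r1) -> 1 <= m ->
  exists s1 s2 P, [/\ r1 < s1, s1 <= s2, s2 < r2, ln (s2 / s1) = m / 2 &
    r2 <= 2 ^+ P * r1 /\ P%:R <= 4 * m].
Proof.
move=> r0 r12 em m1; have q0 : 0 < r2 / r1 by rewrite divr_gt0 //; lra.
pose k : R := expR (m / 4).
have k1 : 1 < k by rewrite /k -[ltLHS]expR0 ltr_expR; lra.
have k4 : k ^+ 4 = r2 / r1.
  by rewrite /k -expRM_natl -[RHS]lnK ?posrE // -em; congr expR; field.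
have e2 : r2 = r1 * k ^+ 4 by rewrite k4; field; rewrite gt_eqF.
have [/andP[h1 h2]] : (Num.truncn (2 * m))%:R <= 2 * m < (Num.truncn (2 * m)).+1%:R.
  by apply: truncn_itv; lra.
move: (Num.truncn _) h1 h2 => p h1 h2.
have ks : 1 < k ^+ 2 by rewrite exprn_egt1.
exists (r1 * k), (r1 * k ^+ 3), p.+1; split.
- by rewrite ltr_pMr.
- by rewrite ler_pM2l // ler_eXnr // ltW.
- by rewrite e2 ltr_pM2l // ltr_eXn2l.
- have -> : r1 * k ^+ 3 / (r1 * k) = k ^+ 2.
    by field; rewrite !gt_eqF //; lra.
  by rewrite /k lnXn ?expR_gt0 // expRK -mulr_natl; field.
split; last by rewrite -[p.+1%:R]natr1; lra.
rewrite -ler_pdivrMr // -[leLHS]lnK ?posrE // -[2 in leRHS]lnK ?posrE // -expRM_natl ler_expR.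
rewrite -em; have := ln2_ge_half; move: h2; set t := _.+1%:R => h2 l2; nra.
Qed.

(** A weak form of Teichmueller's theorem on the modulus of a ring separating
    two points from a third one and infinity. With [a] the point of [K0] farthest
    from [y] and [b] the point of [K1] closest to [y], either there is room for a
    round annulus between [nm (a - y)] and [nm (b - y)], or
    [squeezed_annulus_bound] applies. *)
Lemma thick_annulus_round (Q : nat) : exists M0 : R, forall (A K0 : set C) m y,
  conformal_annulus A -> has_modulus A m -> M0 <= m ->
  (exists B, forall z, A z -> nm z <= B) ->
  components (~` A) K0 -> bounded_set K0 -> K0 y ->
  exists2 rho, 0 < rho & forall z, rho < nm (z - y) < Q.+1%:R * rho -> A z.
Proof.
(* The potential varies by at least [m / 2], and at most [4 * m] dyadic shells
   are needed, so that [(m / 2) ^+ 2 <= kappa * (4 * m)]. *)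
pose kappa : R := 64 * (4 * (Q.+1 + 3))%:R * (160 ^+ 2 * 16).
have kappa0 : 0 <= kappa by rewrite !mulr_ge0.
exists (16 * kappa + 1) => A K0 m y [[oA cA A0 [K' [L' [KL eC]]]] _].
move=> [f0 [w0 [r1 [r2 [r10 r12 [fan [fB finj fsurj]] em]]]]] hm [B hB] cK0 bK0 Ky.
have m1 : 1 <= m by lra.
have [K1 [K01 eC']] : exists K1, K0 <> K1 /\ components (~` A) = [set K0; K1].
  move: cK0; rewrite eC => -[->|->]; first by exists L'.
  by exists K'; split; [exact: nesym | rewrite setUC].
have cK1 : components (~` A) K1 by rewrite eC'; right.
have clA : closed (~` A) by exact: open_closedC.
have [clK0 coK0 _ K0A] := component_props clA cK0.
have [clK1 coK1 [k1 Kk1] K1A] := component_props clA cK1.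
have eA := components_cover eC'.
have dis z : K0 z -> K1 z -> False.
  by move=> a b; apply: K01; exact: (components_disjoint cK0 cK1 a b).
have [B0 hB0] := bounded_set_nm bK0.
have kK0 : compact K0 by exact: bounded_compact clK0 hB0.
have far z : B < nm z -> B0 < nm z -> K1 z.
  move=> h1 h2; have : (~` A) z by move=> /hB; lra.
  by rewrite eA => -[/hB0|//]; lra.
have ncont z0 : continuous (fun z : C => nm (z - z0)).
  move=> z; apply: (continuous_comp (f := fun z => z - z0)); last exact: continuous_nm.
  apply/cvg_nmP => e e0; exists e => // x hx.
  by have -> : x - z0 - (z - z0) = x - z by ring.
have [a] := compact_EVT_max (ex_intro _ y Ky) kK0 (continuous_subspaceT (ncont y)).
rewrite inE => Ka amax.
have {}amax z : K0 z -> nm (z - y) <= nm (a - y) by move=> Kz; apply: amax; rewrite inE.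
have [b Kb bmin] : exists2 b, K1 b & forall z, K1 z -> nm (b - y) <= nm (z - y).
  pose D := K1 `&` [set z | nm (z - y) <= nm (k1 - y)].
  have cD : compact D.
    by rewrite /D setIC; apply: compact_closedI => //; exact: compact_disc.
  have D0 : D !=set0 by exists k1; split => /=.
  have [b] := compact_EVT_min D0 cD (continuous_subspaceT (ncont y)).
  rewrite inE => -[Kb hb] bm; exists b => // z Kz.
  have [h|h] := leP (nm (z - y)) (nm (k1 - y)); last by apply: le_trans hb _; exact: ltW.
  by apply: bm; rewrite inE.
have by0 : 0 < nm (b - y).
  by rewrite nm_gt0 subr_eq0; apply/negP => /eqP e; apply: (dis y) => //; rewrite -e.
have Q0 : 0 < Q.+1%:R :> R by [].
have [lt|le] := ltP (Q.+1%:R * nm (a - y)) (nm (b - y)).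
  exists (nm (b - y) / Q.+1%:R); first by rewrite divr_gt0.
  move=> z /andP[h1 h2]; rewrite mulrC divfK ?gt_eqF // in h2.
  apply: contrapT => nA; have : (~` A) z by [].
  rewrite eA => -[/amax h|/bmin h]; last by lra.
  rewrite ltr_pdivrMr // in h1; have : nm (z - y) * Q.+1%:R <= nm (a - y) * Q.+1%:R.
    by rewrite ler_pM2r.
  lra.
exfalso.
have ay : a != y.
  apply/negP => /eqP e; move: le; rewrite e subrr nm0 mulr0; lra.
pose f z := f0 z - w0.
have fE u v : f u - f v = f0 u - f0 v by rewrite /f; ring.
have loc : locally_linear A f.
  move=> z Az; have [rho rho0 [h1 [L [L0 h2]]]] := injective_nearly_linear oA fan finj Az.
  by exists rho => //; split => //; exists L; split => // u v hu hv; rewrite fE; exact: h2.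
have [s1 [s2 [P [rs1 s12 sr2 lns [rP Pm]]]]] := modulus_radii r10 r12 em m1.
have fr z : A z -> r1 < nm (f z) < r2 by move=> Az; exact: (fB z).
have inj : set_inj A f.
  by move=> u v Au Av e; apply: finj => //; apply: (addIr (- w0)).
have surj w : r1 < nm w < r2 -> (f @` A) w.
  move=> hw; have [|z Az fz] := fsurj (w + w0); first by rewrite /round_annulus /= addrK.
  by exists z => //; rewrite /f fz addrK.
have [K [v [e0 [e1 [[cK KA] vlip vloc [v0 v1] me]]]]] :=
  annulus_potential oA eA kK0 clK1 (ex_intro _ y Ky) (ex_intro _ k1 Kk1) dis hB
    r10 rs1 s12 sr2 fr inj surj loc.
have fr' z : A z -> r1 <= nm (f z) < 2 ^+ P * r1.
  by move=> /fr/andP[h1 h2]; rewrite (ltW h1) (lt_le_trans h2).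
have unb M : exists2 k, K1 k & M <= nm k.
  pose X := `|B| + `|B0| + `|M| + 1.
  have X0 : 0 <= X by rewrite !addr_ge0.
  have h1 := ler_norm B; have h2 := ler_norm B0; have h3 := ler_norm M.
  have h4 := normr_ge0 B; have h5 := normr_ge0 B0; have h6 := normr_ge0 M.
  by exists X%:C%C; [apply: far|]; rewrite nm_real ger0_norm // /X; lra.
have := squeezed_annulus_bound cK KA r10 fr' inj loc vlip vloc coK0 coK1 v0 v1
  Ka Ky ay Kb le unb.
have -> : 64 * (4 * (Q.+1 + 3))%:R * (160 ^+ 2 * (16 * P%:R)) = kappa * P%:R :> R.
  by rewrite /kappa; ring.
rewrite lns in me; move: `|e0 - e1| me => M hM hMP.
have : kappa * P%:R <= kappa * (4 * m) by rewrite ler_wpM2l.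
move: kappa kappa0 hm hMP => c c0 hm hMP hP.
clear -m1 c0 hm hM hMP hP.
have : (m / 2) ^+ 2 <= M ^+ 2 by rewrite lerXn2r ?nnegrE; lra.
nra.
Qed.

End ThickAnnuli.

(** * Thinness through round annuli *)

Section RoundAnnuli.
Variable R : realType.
Local Notation C := (Cplx R).

(** The round annulus lies in a conformal annulus of diameter less than [eps],
    which bounds its size. *)
Lemma thin_at_round (E : set C) y : pointwise_thin_at E y ->
  (exists2 e, E e & e != y) /\
  forall (Q : nat) (eps : R), (0 < Q)%N -> 0 < eps ->
    exists rho, [/\ 0 < rho, Q.+1%:R * rho < eps &
      forall z, E z -> rho < nm (z - y) < Q.+1%:R * rho -> False].
Proof.
move=> [A [m [hA hsep hK mcvg dcvg]]]; split.
  have [[[_ _ _ [K [L [KL eC]]]] _] _] := hA 0%N.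
  have [EA meets] := hsep 0%N; have [K0 [cK0 _ K0y]] := hK 0%N.
  have [L0 [cL0 ne]] : exists L0, components (~` A 0%N) L0 /\ K0 <> L0.
    move: cK0; rewrite eC => -[->|->].
      by exists L; split => //; right.
    by exists K; split; [left | exact: nesym].
  have [e [Ee Le]] := meets _ cL0; exists e => //.
  by apply/eqP => ey; apply: ne; apply: (components_disjoint cK0 cL0 K0y); rewrite -ey.
move=> Q eps Q0 eps0; have [M0 hM0] := thick_annulus_round R Q.
have /cvgryPge/(_ M0)[N1 _ hN1] := mcvg.
have : nbhs (0%:E : \bar R) [set x | (x < eps%:E)%E].
  exact: (@nbhs_open_ereal_lt R 0 (fun=> eps)).
move=> /dcvg[N2 _ hN2]; pose n := maxn N1 N2.
have mn : M0 <= m n by apply: hN1; rewrite /= leq_maxl.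
have dn : (diameter (A n) < eps%:E)%E by apply: hN2; rewrite /= leq_maxr.
have [cA mA] := hA n; have [K0 [cK0 bK0 K0y]] := hK n; have [EA _] := hsep n.
have dist z w : A n z -> A n w -> nm (z - w) < eps.
  move=> Az Aw; rewrite -lte_fin; apply: le_lt_trans dn.
  by apply: ereal_sup_ubound; exists z => //; exists w.
have [a Aa] : A n !=set0 by case: cA => -[].
have bA : exists B, forall z, A n z -> nm z <= B.
  by exists (nm a + eps) => z Az; have := dist z a Az Aa; have := nm_sub z a; lra.
have [rho rho0 hrho] := hM0 (A n) K0 (m n) y cA mA mn bA cK0 bK0 K0y.
have Q1 : 1 <= Q%:R :> R by rewrite ler1n.
have QS : Q.+1%:R = Q%:R + 1 :> R by rewrite natr1.
exists rho; split => //; last first.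
  by move=> z Ez hz; have : (E `&` A n) z by [split => //; exact: hrho]; rewrite EA.
pose s := (1 + Q%:R / 2) * rho.
have s0 : 0 < s by rewrite mulr_gt0 //; lra.
have As : A n (y + s%:C%C).
  apply: hrho; rewrite addrC addKr nm_real gtr0_norm // /s QS.
  by apply/andP; split; nra.
have As' : A n (y - s%:C%C).
  apply: hrho; rewrite addrC addKr nmN nm_real gtr0_norm // /s QS.
  by apply/andP; split; nra.
have := dist _ _ As As'; have -> : y + s%:C%C - (y - s%:C%C) = (2 * s)%:C%C.
  by have -> : 2 * s = s + s; [ring | rewrite rmorphD; ring].
rewrite nm_real ger0_norm; last by lra.
by rewrite /s QS; nra.
Qed.

Lemma components_two (S D X O1 O2 : set C) :
  S = D `|` X -> D !=set0 -> X !=set0 -> connected D -> connected X ->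
  open O1 -> open O2 -> D `<=` O1 -> X `<=` O2 -> (forall z, O1 z -> O2 z -> False) ->
  components S = [set D; X].
Proof.
move=> eS [d Dd] [x Xx] cD cX o1 o2 DO XO dis.
have aux (D' X' O1' O2' : set C) z : S = D' `|` X' -> connected D' -> open O1' ->
    open O2' -> D' `<=` O1' -> X' `<=` O2' -> (forall z, O1' z -> O2' z -> False) ->
    D' z -> connected_component S z = D'.
  move=> eS' cD' o1' o2' DO' XO' dis' Dz; apply/seteqP; split.
    have sub : connected_component S z `<=` O1' `|` O2'.
      move=> w /connected_component_sub; rewrite eS' => -[/DO'|/XO']; by [left|right].
    have [|h|h] := connected_open_split (@component_connected _ S z) o1' o2' sub.
    - by move=> w _; exact: dis'.
    - move=> w cw; have := connected_component_sub cw; rewrite eS' => -[//|/XO' w2].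
      by case: (dis' w (h _ cw)).
    - have Sz : S z by rewrite eS'; left.
      by case: (dis' z (DO' _ Dz)); apply: h; exact: connected_component_refl.
  by apply: connected_component_max => //; rewrite eS'; left.
have eD z : D z -> connected_component S z = D by exact: (aux D X O1 O2).
have eX z : X z -> connected_component S z = X.
  apply: (aux X D O2 O1) => //; first by rewrite setUC.
  by move=> w a b; exact: dis b a.
apply/seteqP; split => [_ [z Sz <-]|_ [->|->]].
- by move: Sz; rewrite {1}eS => -[/eD ->|/eX ->]; [left|right].
- by exists d; [rewrite eS; left | exact: eD].
- by exists x; [rewrite eS; right | exact: eX].
Qed.

Lemma analytic_on_id (A : set C) : analytic_on A id.
Proof.
move=> z _; exists (fun k => if k == 0%N then z else if k == 1%N then 1 else 0).
near=> w; apply: cvg_near_cst; exists 2 => // n /= n2.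
rewrite /series /= (big_cat_nat (n := 2)) //= big_nat_recl // big_nat1 /=.
rewrite big_nat_cond big1 ?addr0.
  by rewrite expr0 mulr1 mul1r expr1 addrC subrK.
by move=> k; rewrite andbT => /andP[k2 _]; case: k k2 => [|[|k]] // _; rewrite mul0r.
Unshelve. all: by end_near. Qed.

Section OneAnnulus.
Variables (z0 : C) (r1 r2 : R).
Hypotheses (r10 : 0 < r1) (r12 : r1 < r2).
Let A := round_annulus z0 r1 r2.

Lemma round_annulus_components : components (~` A) =
  [set [set z | nm (z - z0) <= r1]; [set z | r2 <= nm (z - z0)]].
Proof.
have zz (r : R) : 0 <= r -> nm (z0 + r%:C%C - z0) = r.
  by move=> h; rewrite addrC addKr nm_real ger0_norm.
have r20 : 0 < r2 := lt_trans r10 r12.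
have [mid m1 m2] : exists2 mid, r1 < mid & mid < r2.
  by exists ((r1 + r2) / 2); [rewrite midf_lt | rewrite midf_lt].
apply: (@components_two _ _ _ [set z | nm (z - z0) < mid] [set z | mid < nm (z - z0)]).
- have AE z : A z = (r1 < nm (z - z0) < r2) :> Prop by [].
  apply/seteqP; split => z; rewrite /setC /setU /mkset AE.
    move=> h; have [h1|h1] := leP (nm (z - z0)) r1; first by left.
    by right; rewrite leNgt; apply/negP => h2; apply: h; rewrite h1 h2.
  by move=> [h|h] /andP[a b]; lra.
- by exists z0; rewrite /= subrr nm0 ltW.
- by exists (z0 + r2%:C%C); rewrite /= zz // ltW.
- exact: connected_disc.
- exact: connected_exterior.
- apply/open_nm => z hz /=; exists (mid - nm (z - z0)); first by rewrite subr_gt0.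
  by move=> w hw; have := nm_tri w z z0; lra.
- apply/open_nm => z hz /=; exists (nm (z - z0) - mid); first by rewrite subr_gt0.
  by move=> w hw; have := nm_tri z w z0; rewrite (nmB z w); lra.
- by move=> z /= h; exact: le_lt_trans m1.
- by move=> z /= h; exact: lt_le_trans h.
- by move=> z /= h1 h2; have := lt_trans h1 h2; rewrite ltxx.
Qed.

Lemma round_annulus_has_modulus : has_modulus A (ln (r2 / r1)).
Proof.
exists id, z0, r1, r2; split => //; split; first exact: analytic_on_id.
by split => // z Az; exists z.
Qed.

Lemma round_annulus_conformal : conformal_annulus A.
Proof.
split; last by exists (ln (r2 / r1)); exact: round_annulus_has_modulus.
split.
- apply/open_nm => z /andP[a b]; rewrite -/(nm (z - z0)) in a b.
  exists (Num.min (nm (z - z0) - r1) (r2 - nm (z - z0))).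
    by rewrite lt_min !subr_gt0 a b.
  move=> w; rewrite lt_min => /andP[c d]; suff : r1 < nm (w - z0) < r2 by [].
  apply/andP.
  have := nm_tri w z z0; have := nm_tri z w z0; rewrite (nmB z w).
  by move=> e f; split; lra.
- exact: (@connected_annulus R z0 r1 r2 (ltW r10) r12).
- exists (z0 + ((r1 + r2) / 2)%:C%C).
  have m0 : 0 < (r1 + r2) / 2 by rewrite divr_gt0 // addr_gt0 // (lt_trans r10).
  suff : r1 < nm (z0 + ((r1 + r2) / 2)%:C%C - z0) < r2 by [].
  by rewrite addrC addKr nm_real gtr0_norm // !midf_lt.
- exists [set z | nm (z - z0) <= r1], [set z | r2 <= nm (z - z0)].
  split; last exact: round_annulus_components.
  move=> e; have : [set z | nm (z - z0) <= r1] z0 by rewrite /= subrr nm0 ltW.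
  by rewrite e /= subrr nm0 leNgt (lt_trans r10).
Qed.

Lemma round_annulus_diameter : (0%:E <= diameter A <= (2 * r2)%:E)%E.
Proof.
have [_ _ [z Az] _] : doubly_connected A by case: round_annulus_conformal.
apply/andP; split.
  apply: ereal_sup_ubound; exists z => //; exists z => //.
  by rewrite -/(nm _) subrr nm0.
apply: ge_ereal_sup => _ [u /andP[_ hu] [w /andP[_ hw] <-]].
rewrite -/(nm (u - z0)) in hu; rewrite -/(nm (w - z0)) in hw.
rewrite lee_fin -/(nm (u - w)); have := nm_tri u z0 w; rewrite (nmB z0 w); lra.
Qed.

End OneAnnulus.

(** Taking the annuli smaller than [nm (e - z0)] leaves [e] outside all of them,
    so that they separate [E]. *)
Lemma round_thin_at (E : set C) z0 : E z0 -> (exists2 e, E e & e != z0) ->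
  (forall (Q : nat) (eps : R), 0 < eps ->
    exists rho, [/\ 0 < rho, Q.+1%:R * rho < eps &
      forall z, E z -> rho < nm (z - z0) < Q.+1%:R * rho -> False]) ->
  pointwise_thin_at E z0.
Proof.
move=> Ez [e Ee ne] h; have e0 : 0 < nm (e - z0) by rewrite nm_gt0 subr_eq0.
have /choice[rho hrho] : forall n : nat, exists rho, [/\ 0 < rho,
    n.+2%:R * rho < Num.min (nm (e - z0)) (n.+1%:R^-1 / 2) &
    forall z, E z -> rho < nm (z - z0) < n.+2%:R * rho -> False].
  by move=> n; apply: h; rewrite lt_min e0 divr_gt0 // invr_gt0.
have r0 n : 0 < rho n by case: (hrho n).
have r12 n : rho n < n.+2%:R * rho n by rewrite ltr_pMl // ltr1n.
have re n : n.+2%:R * rho n < nm (e - z0).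
  by case: (hrho n) => _; rewrite lt_min => /andP[].
have rn n : 2 * (n.+2%:R * rho n) <= n.+1%:R^-1.
  by case: (hrho n) => _; rewrite lt_min => /andP[_ h1] _; rewrite mulrC -ler_pdivlMr // ltW.
exists (fun n => round_annulus z0 (rho n) (n.+2%:R * rho n)), (fun n => ln (n.+2%:R)).
split.
- move=> n; split; first exact: round_annulus_conformal.
  have := round_annulus_has_modulus z0 (r0 n) (r12 n).
  by rewrite mulfK // gt_eqF.
- move=> n; split.
    by apply/seteqP; split => // z [Ez' Az]; case: (hrho n) => _ _ /(_ z Ez'); apply.
  rewrite round_annulus_components // => K [->|->].
    by exists z0; split => //=; rewrite subrr nm0 ltW.
  by exists e; split => //=; exact: ltW.
- move=> n; exists [set z | nm (z - z0) <= rho n]; split.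
  + by rewrite round_annulus_components //; left.
  + apply: (@nm_bounded_set _ _ (rho n + nm z0)) => z /= hz.
    by have := nm_sub z z0; lra.
  + by rewrite /= subrr nm0 ltW.
- apply/cvgryPge => M; exists (Num.bound (expR M)) => // n /= hn.
  rewrite -[M]expRK ler_ln ?posrE ?expR_gt0 //.
  apply: (le_trans (ltW (archi_boundP (expR_ge0 M)))).
  by rewrite ler_nat; apply: (leq_trans hn); rewrite -addn2 leq_addr.
- apply: (@squeeze_cvge _ _ _ _ (fun=> 0%:E) _ (EFin \o harmonic)).
  + near=> n; have /andP[a b] := round_annulus_diameter z0 (r0 n) (r12 n).
    rewrite a /=; apply: le_trans b _; rewrite lee_fin; exact: rn.
  + exact: cvg_cst.
  + exact: cvge_harmonic.
Unshelve. all: by end_near. Qed.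

End RoundAnnuli.

(** * Transporting thinness by an analytic map *)

Section Transfer.
Variable R : realType.
Local Notation C := (Cplx R).

Lemma compact_image (K : set C) f : compact K -> (forall z, K z -> finite_order f z) ->
  compact (f @` K).
Proof.
move=> cK hf; apply: continuous_compact => //.
by apply: continuous_in_subspaceT => z; rewrite inE => /hf; exact: finite_order_continuous.
Qed.

(** Near [y] the map multiplies logarithmic distances to [y] by about its local
    degree, so round gaps of [K] around [y] become round gaps of [f @` K]
    around [f y]. The rest [G] of [E] stays away from [f y]. *)
Lemma finite_order_thin (E K G : set C) f y :
  closed G -> ~ G (f y) -> K y -> compact K -> (forall z, K z -> finite_order f z) ->
  f @` K `<=` E -> E `<=` f @` K `|` G ->
  (forall w, K w -> f w = f y -> w = y) ->
  pointwise_thin_at K y -> pointwise_thin_at E (f y).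
Proof.
move=> clG nG Ky cK hf fKE EfK only thin.
have [[e Ke ey] gaps] := thin_at_round thin.
have [p [c1 [c2 [r [p0 c10 c20 r0 hfy]]]]] := hf y Ky.
apply: round_thin_at; first by apply: fKE; exists y.
  exists (f e); first by apply: fKE; exists e.
  by apply/eqP => fe; move/eqP: ey; apply; exact: only.
move=> Q eps eps0.
pose G2 := G `|` f @` (K `&` ~` [set w | nm (w - y) < r]).
have oball : open [set w | nm (w - y) < r].
  apply/open_nm => w hw; exists (r - nm (w - y)); first by rewrite subr_gt0.
  by move=> u hu /=; have := nm_tri u w y; rewrite /= in hw; lra.
have clG2 : closed G2.
  apply: closedU => //; apply: (compact_closed (@hausdorff_C R)).
  apply: compact_image => [|z [Kz _]]; last exact: hf.
  by apply: compact_closedI => //; exact: open_closedC.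
have nG2 : ~ G2 (f y).
  by move=> [//|[w [Kw nw] fw]]; apply: nw; rewrite /= (only w Kw fw) subrr nm0.
have /open_nm/(_ (f y) nG2)[eta eta0 heta] := closed_openC clG2.
have Q0 : 0 < Q.+1%:R :> R by [].
have [Q' Q'0 hQ'] : exists2 Q' : nat, (0 < Q')%N & c2 * Q.+1%:R <= c1 * Q'.+1%:R ^+ p.
  exists (Num.bound (c2 * Q.+1%:R / c1)).+1 => //; set N := Num.bound _.
  have : c2 * Q.+1%:R / c1 < N%:R by apply: archi_boundP; rewrite divr_ge0 ?mulr_ge0 // ltW.
  rewrite ltr_pdivrMr // => h; apply: (le_trans (ltW h)).
  rewrite mulrC ler_pM2l //; apply: (@le_trans _ _ (N.+2%:R)).
    by rewrite ler_nat -addn2 leq_addr.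
  by rewrite -[leLHS]expr1; apply: ler_weXn2l => //; rewrite ler1n.
pose eps' := Num.min (Num.min 1 r) (Num.min eps eta / c1).
have eps'0 : 0 < eps' by rewrite !lt_min ltr01 r0 /= divr_gt0 // lt_min eps0.
have e1 : eps' <= 1 by rewrite /eps' !ge_min lexx.
have e2 : c1 * eps' <= Num.min eps eta.
  by rewrite mulrC -ler_pdivlMr // /eps' ge_min lexx orbT.
have [rho0 [rho00 hrho gap]] := gaps Q' eps' Q'0 eps'0.
have q0 : 0 < Q'.+1%:R * rho0 by rewrite mulr_gt0.
have small : c1 * (Q'.+1%:R * rho0) ^+ p < Num.min eps eta.
  apply: (lt_le_trans _ e2); rewrite ltr_pM2l //; apply: (le_lt_trans _ hrho).
  rewrite -[leRHS]expr1; apply: ler_wiXn2l => //; first exact: ltW.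
  exact: ltW (lt_le_trans hrho e1).
have big : Q.+1%:R * (c2 * rho0 ^+ p) <= c1 * (Q'.+1%:R * rho0) ^+ p.
  by rewrite exprMn !mulrA ler_pM2r ?exprn_gt0 // mulrC.
exists (c2 * rho0 ^+ p); split.
- by rewrite mulr_gt0 // exprn_gt0.
- by have := le_lt_trans big small; rewrite lt_min => /andP[].
move=> z Ez /andP[z1 z2].
have zeta : nm (z - f y) < eta.
  by have := lt_trans z2 (le_lt_trans big small); rewrite lt_min => /andP[].
have nz : ~ G2 z := heta z zeta.
have [[w Kw fw]|Gz] := EfK z Ez; last by apply: nz; left.
have wr : nm (w - y) < r.
  by apply: contrapT => h; apply: nz; right; exists w.
have /andP[b1 b2] := hfy w wr; rewrite fw in b1 b2.
have n0 := nm_ge0 (w - y).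
apply: (gap w Kw); apply/andP; split; rewrite ltNge; apply/negP => h.
- have : nm (w - y) ^+ p <= rho0 ^+ p by rewrite lerXn2r ?nnegrE // ltW.
  by rewrite -(ler_pM2l c20); lra.
- have : (Q'.+1%:R * rho0) ^+ p <= nm (w - y) ^+ p by rewrite lerXn2r ?nnegrE // ltW.
  by rewrite -(ler_pM2l c10); lra.
Qed.

End Transfer.

Section Compositions.
Variable R : realType.
Local Notation C := (Cplx R).
Variables (U X : set C) (I : nat -> Type) (phi : forall j, I j -> C -> C).
Hypothesis hPhi : is_analytic_NIFS U X phi.

Lemma compositions_add j a b f : compositions phi j (a + b) f <->
  exists g h, [/\ compositions phi j a g, compositions phi (j + a) b h & f = g \o h].
Proof.
elim: a j f => [|a IH] j f.
  rewrite add0n addn0; split; first by move=> hf; exists id, f.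
  by move=> [g [h [-> hh ->]]].
rewrite addSn /= addnS -addSn; split.
  move=> [g1 g1r [h1 /IH[g [h [hg hh ->]]] <-]].
  by exists (g1 \o g), h; split => //; exists g1 => //; exists g.
move=> [_ [h [[g1 g1r [g hg <-]] hh ->]]].
by exists g1 => //; exists (g \o h) => //; apply/IH; exists g, h.
Qed.

Lemma compositions_sub j k f : (0 < j)%N -> compositions phi j k f ->
  (forall z, U z -> U (f z)) /\ (forall z, X z -> X (f z)).
Proof.
have [hN _] := hPhi; elim: k j f => [|k IH] j f j0 /=; first by move=> ->.
move=> [_ [i _ <-] [g /(IH j.+1 g isT)[gU gX] <-]].
have XU := nifs_sub hN; have mi := nifs_map hN i j0.
by split => z hz /=; [apply/XU/mi/gU | apply/mi/XU/gX].
Qed.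

Lemma compositions_finite_order j k f z : (0 < j)%N -> compositions phi j k f ->
  U z -> finite_order f z.
Proof.
have [hN hA] := hPhi; elim: k j f => [|k IH] j f j0 /=.
  by move=> -> _; exact: finite_order_id.
move=> [_ [i _ <-] [g hg <-]] Uz.
have [gU _] := compositions_sub (ltn0Sn j) hg.
apply: finite_order_comp; first exact: IH hg Uz.
have [p [c [K [r ml]]]] := nonconstant_monomial_like (nifs_domain_open hN)
  (nifs_domain_connected hN) (hA j i j0) (nifs_nonconstant hN i j0) (gU z Uz).
exact: monomial_like_finite_order ml.
Qed.

Lemma level_set_add j a b : level_set phi X j (a + b) =
  \bigcup_(f in compositions phi j a) (f @` level_set phi X (j + a) b).
Proof.
apply/seteqP; split => [z [f /compositions_add[g [h [hg hh ->]]] [x Xx <-]]|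
                        z [g hg [_ [h hh [x Xx <-]] <-]]].
  by exists g => //; exists (h x) => //; exists h => //; exists x.
by exists (g \o h); [apply/compositions_add; exists g, h | exists x].
Qed.

Lemma level_set_sub j k : (0 < j)%N -> level_set phi X j k `<=` X.
Proof.
by move=> j0 _ [f hf [x Xx <-]]; have [_] := compositions_sub j0 hf; apply.
Qed.

Lemma level_set_anti j k l : (0 < j)%N -> (k <= l)%N ->
  level_set phi X j l `<=` level_set phi X j k.
Proof.
move=> j0 kl; rewrite -(subnKC kl) level_set_add => _ [f hf [x hx <-]].
exists f => //; exists x => //; apply: level_set_sub hx.
by rewrite addn_gt0 j0.
Qed.

Lemma limit_set_from_sub j : (0 < j)%N -> limit_set_from phi X j `<=` X.
Proof. by move=> j0 z /(_ 1%N isT); exact: level_set_sub. Qed.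

Lemma compositions_limit_set k f z : compositions phi 1 k f ->
  limit_set_from phi X k.+1 z -> limit_set phi X (f z).
Proof.
move=> hf hz l /= l0; apply: (@level_set_anti 1 l (k + l)) => //; first exact: leq_addl.
by rewrite level_set_add; exists f => //; exists z => //; exact: hz.
Qed.

(** The preimages [y k] of [x] accumulate at some [p] in [X]; as [p] is isolated
    in the fibre of [f], infinitely many of them are equal to it. *)
Lemma limit_set_preimage f j x : (0 < j)%N -> (forall z, U z -> finite_order f z) ->
  (forall k, (0 < k)%N -> (f @` level_set phi X j k) x) ->
  (f @` limit_set_from phi X j) x.
Proof.
have [hN _] := hPhi => j0 hf hx.
have : forall k, exists y, (0 < k)%N -> level_set phi X j k y /\ f y = x.
  by move=> [|k]; [exists 0 | have [y h <-] := hx k.+1 isT; exists y].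
move=> /choice[y hy].
have cX : compact X := nifs_compact hN.
have [|p [Xp clp]] := cX (y @ \oo) _.
  by exists 1%N => // k /= k1; have [yl _] := hy k k1; exact: level_set_sub yl.
have pf := hf p (nifs_sub hN Xp).
have tail k0 : (y @ \oo) [set w | exists2 k, (k0 < k)%N & y k = w].
  by exists k0.+1 => // k /= hk; exists k.
have fp : f p = x.
  apply/eqP/negPn/negP => ne; have e0 : 0 < nm (x - f p).
    by rewrite nm_gt0 subr_eq0 eq_sym.
  have /cvg_nmP/(_ _ e0)[d d0 hd] := finite_order_continuous pf.
  have nb : nbhs p [set w | nm (w - p) < d] by apply/nbhs_nm; exists d.
  have [_ [[k hk <-] /= hw]] := clp _ _ (tail 0%N) nb.
  by have [_ e] := hy k hk; have := hd _ hw; rewrite e ltxx.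
exists p => // k /= k0.
have [_ [[l hl <-] /= hw]] := clp _ _ (tail k) (finite_order_isolated pf).
have [yl e] := hy l (leq_ltn_trans (leq0n _) hl).
rewrite -hw ?e ?fp //; exact: level_set_anti (ltnW hl) _ yl.
Qed.

End Compositions.

(** * Limit sets *)

Section LimitSets.
Variable R : realType.
Local Notation C := (Cplx R).
Variables (U X : set C) (I : nat -> Type) (phi : forall j, I j -> C -> C).
Hypothesis hPhi : is_analytic_NIFS U X phi.

Lemma restrictE (f : C -> C) z : U z -> (f \_ U) z = f z.
Proof. by move=> Uz; rewrite patchT // inE. Qed.

Lemma restrict_image (f : C -> C) (S : set C) : S `<=` U -> (f \_ U) @` S = f @` S.
Proof.
move=> SU; apply/seteqP; split => _ [z Sz <-]; exists z => //.
  by rewrite restrictE //; exact: SU.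
by rewrite restrictE //; exact: SU.
Qed.

(** If every map failed to reach [x] from some level, then by finiteness they
    would all fail from a common level, although [x] lies in all of them. *)
Lemma limit_set_finite_cover n : (0 < n)%N ->
  finite_set (compositions_on phi U 1 n) ->
  limit_set phi X `<=`
    \bigcup_(F in compositions_on phi U 1 n) (F @` limit_set_from phi X n.+1).
Proof.
have [hN _] := hPhi => n0 fin x Jx; have XU := nifs_sub hN.
have levU k : level_set phi X n.+1 k `<=` U.
  by move=> z /(level_set_sub hPhi (ltn0Sn n))/XU.
suff [F hF hx] : exists2 F, compositions_on phi U 1 n F &
    forall k, (0 < k)%N -> (F @` level_set phi X n.+1 k) x.
  exists F => //; have [f hf eF] := hF.
  rewrite -eF restrict_image; last by move=> z /(limit_set_from_sub hPhi (ltn0Sn n))/XU.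
  apply: (limit_set_preimage hPhi) => // [z|k k0].
    exact: (compositions_finite_order hPhi _ hf).
  by have := hx k k0; rewrite -eF restrict_image.
apply: contrapT => nF.
have : forall F : C -> C, exists k, compositions_on phi U 1 n F ->
    (0 < k)%N /\ ~ (F @` level_set phi X n.+1 k) x.
  move=> F; have [hF|] := pselect (compositions_on phi U 1 n F); last by exists 0%N.
  apply: contrapT => h; apply: nF; exists F => // k k0; apply: contrapT => hk.
  by apply: h; exists k.
move=> /choice[kF hkF].
have /finite_seqP[s es] := finite_image kF fin.
pose N := \max_(i <- s) i.
have kN F : compositions_on phi U 1 n F -> (kF F <= N)%N.
  move=> hF; have : (kF @` compositions_on phi U 1 n) (kF F) by exists F.
  by rewrite es /= => h; rewrite /N (leq_bigmax_seq _ h).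
have nN : (0 < n + N)%N by rewrite addn_gt0 n0.
have := Jx (n + N)%N nN; rewrite level_set_add => -[f hf xf].
have hF : compositions_on phi U 1 n (f \_ U) by exists f.
have [k0] := hkF _ hF; apply.
rewrite restrict_image //; case: xf => w hw <-; exists w => //.
exact: (level_set_anti hPhi _ (kN _ hF)).
Qed.

End LimitSets.

Unset Implicit Arguments.

Theorem theorem1p4 (R : realType) (U X : set (Cplx R)) (I : nat -> Type)
    (phi : forall j, I j -> Cplx R -> Cplx R) (n : nat)
    (hPhi : is_analytic_NIFS U X phi) (hn : (1 < n)%N)
    (h_thin : pointwise_thin (closure (limit_set_from phi X n)))
    (h_finite : finite_set (compositions_on phi U 1 n.-1))
    (h_disjoint : forall f g,
       compositions_on phi U 1 n.-1 f -> compositions_on phi U 1 n.-1 g ->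
       f <> g ->
       (f @` closure (limit_set_from phi X n)) `&`
         (g @` closure (limit_set_from phi X n)) = set0)
    (h_only : forall f z,
       compositions_on phi U 1 n.-1 f ->
       closure (limit_set_from phi X n) z ->
       forall w, closure (limit_set_from phi X n) w -> f w = f z -> w = z) :
  pointwise_thin (closure (limit_set phi X)).
Proof.
have [hN _] := hPhi; have XU := nifs_sub hN; have cX := nifs_compact hN.
have n0 : (0 < n)%N by exact: ltnW.
have nS : n.-1.+1 = n by rewrite prednK.
have n10 : (0 < n.-1)%N by rewrite -ltnS nS.
set J := limit_set_from phi X n in h_thin h_disjoint h_only *.
set K := closure J in h_thin h_disjoint h_only *.
set CO := compositions_on phi U 1 n.-1 in h_finite h_disjoint h_only *.
have clX : closed X := compact_closed (@hausdorff_C R) cX.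
have KX : K `<=` X.
  rewrite /K; have /closure_id -> := clX.
  by apply: closureS; exact: (limit_set_from_sub hPhi n0).
have cK : compact K by apply: (subclosed_compact (@closed_closure _ _) cX KX).
have KU : K `<=` U by move=> z /KX/XU.
have COf F : CO F -> exists2 f, compositions phi 1 n.-1 f &
    (F = f \_ U) /\ F @` K = f @` K.
  by move=> [f hf <-]; exists f => //; split => //; rewrite restrict_image.
have fo f z : compositions phi 1 n.-1 f -> K z -> finite_order f z.
  by move=> hf /KU; apply: (compositions_finite_order hPhi _ hf).
have clFK F : CO F -> closed (F @` K).
  move=> /COf[f hf [_ ->]]; apply: (compact_closed (@hausdorff_C R)).
  by apply: compact_image => // z; exact: fo.
have KE f : compositions phi 1 n.-1 f -> f @` K `<=` closure (limit_set phi X).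
  move=> hf _ [z Kz <-] P /(finite_order_continuous (fo f z hf Kz))/Kz[w [Jw Pw]].
  by exists (f w); split => //; apply: (compositions_limit_set hPhi hf); rewrite nS.
have cover : closure (limit_set phi X) `<=` \bigcup_(F in CO) (F @` K).
  have /closure_id -> : closed (\bigcup_(F in CO) (F @` K)) by exact: closed_bigcup.
  apply: closureS => x /(limit_set_finite_cover hPhi n10 h_finite)[F hF [z Jz <-]].
  by exists F => //; exists z => //; apply: subset_closure; rewrite /J -nS.
move=> z0 Ez0; have [F hF [y Ky Fy]] := cover z0 Ez0.
have [f hf [eF FK]] := COf F hF.
have fF z : K z -> F z = f z by move=> /KU Uz; rewrite eF restrictE.
pose G := \bigcup_(F' in CO `&` [set F' | F' <> F]) (F' @` K).
have clG : closed G.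
  apply: closed_bigcup => [|F' [hF' _]]; last exact: clFK.
  by apply: sub_finite_set h_finite => F' [].
rewrite -Fy fF //; apply: (@finite_order_thin R _ K G) => //.
- move=> [F' [hF' ne] [w Kw e]]; have : (F' @` K `&` F @` K) (f y).
    by split; [exists w | exists y => //; exact: fF].
  by rewrite h_disjoint.
- by move=> z Kz; exact: fo.
- exact: KE.
- move=> z /cover[F' hF' Fz]; have [e|ne] := pselect (F' = F).
    by left; rewrite -FK -e.
  by right; exists F'.
- by move=> w Kw e; apply: (h_only F y) => //; rewrite !fF.
- exact: h_thin.
Qed.
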